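(* Consider the thruster model of the context with $x_T$ as a free real parameter, and assume for all other parameters that $X_{u|u|}<0$, $\tau(0)>0$ and that the constants $k_{20},k_{21},k_{10},k_{11},k_{02},k_{01}$ of the context are all positive. The stability region and the stability boundary refer to the quadrant $\varepsilon_r,\varepsilon_\psi\ge 0$. Then two scenarios occur. (1) Case $x_{T_2}<x_{T_1}$. (1a) For any $x_T\le x_{T_2}$ and all $\underline{\varepsilon}_r>0$, $\underline{\varepsilon}_\psi\ge0$: as $s\ge 0$ increases, the equilibrium $(u_0,0,0,0)$ is stabilized when the control parameters $(\varepsilon_r,\varepsilon_\psi)=s\cdot(\underline{\varepsilon}_r,\underline{\varepsilon}_\psi)$ cross the curve $\mathcal C$ of the context; this crossing point lies at a unique $s^*>0$ for each fixed $(\underline{\varepsilon}_r,\underline{\varepsilon}_\psi)$; for $\underline{\varepsilon}_\psi>0$ a complex conjugate pair of eigenvalues of $A$ traverses the imaginary axis as $s$ crosses $s^*$, while for $\underline{\varepsilon}_\psi=0$ one eigenvalue of $A$ is fixed at zero and a real eigenvalue (simple as an eigenvalue of the 3D reduction $S$) traverses zero at $s=s^*$. Furthermore, the stability boundary is a vertical line or (the graph of) a strictly monotone function of $\varepsilon_r$, which intersects the $\varepsilon_r$-axis, but possibly does not intersect the $\varepsilon_\psi$-axis, having instead a vertical asymptote at $\varepsilon_r=\varepsilon_r^*$. (1b) If $x_T\ge x_{T_s}$, the straight motion cannot be stabilized by any $\varepsilon_r,\varepsilon_\psi>0$. (1c) If $x_{T_2}<x_T<x_{T_s}$, the stability region is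 bounded, with boundary of parabolic shape that intersects the $\varepsilon_r$-axis twice. (2) Case $x_{T_1}\le x_{T_2}$. The stability boundary is strictly monotone or vertical if $x_T<x_{T_1}$, and otherwise (i.e. for $x_T\ge x_{T_1}$) stabilization is impossible. In all cases which admit stabilization, the real part of the critical eigenvalue(s) has non-zero derivative as $(\varepsilon_r,\varepsilon_\psi)$, with $\varepsilon_r,\varepsilon_\psi\ge0$, transversally crosses the stability boundary along a curve (transversal crossing means that the tangent vector of the curve at the crossing point is linearly independent of the tangent vector of the stability boundary).
   Context: **Thruster model.** For $(u,v,r,\psi)$ near $(u_0,0,0,0)$ with $u_0>0$, the system is $$M\begin{pmatrix}\dot u\\ \dot v\\ \dot r\\ \dot\psi\end{pmatrix}=\begin{pmatrix} m v r+X_H+\tau(u)\cos\eta\\ -m u r+Y_H+\tau(u)\sin\eta\\ N_H+x_T\tau(u)\sin\eta\\ r\end{pmatrix},\qquad M=\begin{pmatrix} m+m_{uu}&0&0&0\\0&m+m_{vv}&m_{vr}&0\\0&m_{rv}&I_z+m_{rr}&0\\0&0&0&1\end{pmatrix},$$ with steering law $\eta=\varepsilon_r r+\varepsilon_\psi\psi$, control gains $\varepsilon_r,\varepsilon_\psi\ge0$, real coefficients, $M$ invertible and $m+m_{uu}>0$. With $V=\sqrt{u^2+v^2}$ the hull forces are $$X_H=X_{u|u|}u^2+X_{\beta\gamma}vr,$$ $$Y_H=Y_\beta uv+Y_\gamma ur+Y_{\beta|\beta|}v|v|+Y_{\gamma|\gamma|}r|r|+Y_{\beta|\gamma|}v|r|+Y_{|\beta|\gamma}|v|r+Y_{ab}u^3|v|vV^{-3},$$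 $$N_H=N_\beta uv+N_\gamma ur+N_{u'\gamma c}u|r|rV^{-1}+N_{\gamma|\gamma|}r|r|+N_{\beta|\beta|}v|v|+N_{\beta\beta\gamma}rv^2V^{-1}+N_{\beta\gamma\gamma}vr^2V^{-1}+N_{ab}uv^3V^{-2}.$$ The propeller force is the polynomial $\tau(u)=2(1-t)\frac{L_{pp}}{T}D_p^4\sum_{i=0}^5K_{Ti}\left(\frac{1-w}{D_p}u\right)^i$ with real constants, and it is assumed throughout that $\partial_u\tau(u)<0$ for $u>0$. **Straight motion.** $u_0>0$ is the unique positive solution of $X_{u|u|}u_0^2+\tau(u_0)=0$; $(u_0,0,0,0)$ is the straight motion equilibrium. **Linearization.** $A=M^{-1}J$ with $$J=\begin{pmatrix}2X_{u|u|}u_0+\partial_u\tau(u_0)&0&0&0\\0&Y_\beta u_0&(Y_\gamma-m)u_0+\tau(u_0)\varepsilon_r&\tau(u_0)\varepsilon_\psi\\0&N_\beta u_0&N_\gamma u_0+x_T\tau(u_0)\varepsilon_r&x_T\tau(u_0)\varepsilon_\psi\\0&0&1&0\end{pmatrix}.$$ $S$ denotes the upper left $3\times3$ submatrix of $A$ (the 3D reduction to $(u,v,r)$, used when $\varepsilon_\psi=0$). **Stabilized** means: the equilibrium is exponentially asymptotically stable, up to the symmetry in $\psi$ when $\varepsilon_\psi=0$; equivalently, all eigenvalues of $A$ (if $\varepsilon_\psi>0$), respectively of $S$ (if $\varepsilon_\psi=0$), have strictly negative real part. The stability region is the set of $(\varepsilon_r,\varepsilon_\psi)$ with $\varepsilon_r,\varepsilon_\psi\ge0$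 for which this holds; the stability boundary is its boundary relative to the quadrant $\varepsilon_r,\varepsilon_\psi\ge0$. Critical eigenvalues are those on the imaginary axis at the stability boundary (for $\varepsilon_\psi=0$, disregarding the zero eigenvalue of $A$ that is present for all $\varepsilon_r$). **Constants.** With $D=(m+m_{vv})(I_z+m_{rr})-m_{rv}m_{vr}$, $$k_{20}=D^{-1}m_{rv}\tau(u_0),\quad k_{21}=D^{-1}(m+m_{vv})\tau(u_0),\quad k_{10}=-D^{-1}N_\beta u_0\tau(u_0),\quad k_{11}=-D^{-1}Y_\beta u_0\tau(u_0),$$ $$k_{02}=D^{-1}[m_{vr}N_\beta-(I_z+m_{rr})Y_\beta-(m+m_{vv})N_\gamma+m_{rv}(Y_\gamma-m)]u_0,\quad k_{01}=-D^{-1}(mN_\beta+N_\gamma Y_\beta-N_\beta Y_\gamma)u_0^2.$$ The characteristic polynomial of the lower right $3\times3$ block of $A$ is $\lambda^3+c_2\lambda^2+c_1\lambda+c_0$ with $$c_0=(k_{10}-k_{11}x_T)\varepsilon_\psi,\quad c_1=-k_{01}+(k_{10}-k_{11}x_T)\varepsilon_r+(k_{20}-k_{21}x_T)\varepsilon_\psi,\quad c_2=k_{02}+(k_{20}-k_{21}x_T)\varepsilon_r.$$ **Curve $\mathcal C$.** $\mathcal C$ is the set of $(\varepsilon_r,\varepsilon_\psi)$ with $c_1c_2=c_0$. Where the denominator is non-zero, this is the graph $$\varepsilon_\psi(\varepsilon_r;x_T)=\frac{\big(k_{02}+(k_{20}-k_{21}x_T)\varepsilon_r\big)\big((k_{10}-k_{11}x_T)\varepsilon_r-k_{01}\big)}{k_{10}-k_{11}x_T-(k_{20}-k_{21}x_T)\big(k_{02}+(k_{20}-k_{21}x_T)\varepsilon_r\big)},$$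 whose denominator, for $x_T\ne x_{T_2}$, has the unique root $$\varepsilon_r^*=\frac{k_{10}-k_{02}k_{20}-(k_{11}-k_{02}k_{21})x_T}{(k_{20}-k_{21}x_T)^2}.$$ If $\varepsilon_r^*=k_{01}/(k_{10}-k_{11}x_T)$, the set $\mathcal C$ contains the vertical line $\varepsilon_r=\varepsilon_r^*$. **Thresholds.** $$x_{T_1}=\frac{k_{10}}{k_{11}}=\frac{N_\beta}{Y_\beta},\qquad x_{T_2}=\frac{k_{20}}{k_{21}}=\frac{m_{rv}}{m+m_{vv}},\qquad x_{T_s}=\frac{k_{01}k_{20}+k_{02}k_{10}}{k_{01}k_{21}+k_{02}k_{11}}.$$
   Formalization: In (1a) at x_T=x_{T_2}, rays with ε_ψ≥k_02 ε_r miss C and are excluded from the crossing claim; no ε_ψ-intercept/asymptote is claimed there (ε_r* undefined). At ε_ψ=0 with critical eigenvalue 0, curves leaving the axis need ε_ψ twice differentiable; then some eigenvalue branch of A moves. *)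

(* Defs.v *)
From HB Require Import structures.
From mathcomp Require Import all_boot all_order all_algebra.
From mathcomp Require Import all_classical all_reals all_analysis.
From mathcomp Require Import complex.
From mathcomp Require Import ring lra.

Set Implicit Arguments.
Unset Strict Implicit.
Unset Printing Implicit Defensive.

Import Order.TTheory GRing.Theory Num.Theory.
Import numFieldNormedType.Exports.

Local Open Scope classical_set_scope.
Local Open Scope ring_scope.

(* All parameters of the thruster model except the propeller position x_T and
   the control gains. In the names of hydrodynamic coefficients b stands for
   beta and c for gamma; Y_bb, Y_cc, N_bb, N_cc are Y_{beta|beta|} etc.,
   Y_b_absc is Y_{beta|gamma|}, Y_absb_c is Y_{|beta|gamma}, and N_uc is
   N_{u' gamma c}. *)
Record params (R : realType) := Params {
  mass : R; m_uu : R; m_vv : R; m_vr : R; m_rv : R; m_rr : R; I_z : R;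
  X_uu : R; X_bc : R;
  Y_b : R; Y_c : R; Y_bb : R; Y_cc : R; Y_b_absc : R; Y_absb_c : R; Y_ab : R;
  N_b : R; N_c : R; N_uc : R; N_cc : R; N_bb : R; N_bbc : R; N_bcc : R;
  N_ab : R;
  thrust_deduction : R; wake : R; L_pp : R; draft : R; D_p : R;
  K_T : 'I_6 -> R
}.

Section Model.
Variables (R : realType) (p : params R).

Definition tau (u : R) : R :=
  2 * (1 - thrust_deduction p) * (L_pp p / draft p) * D_p p ^+ 4 *
  \sum_(i < 6) K_T p i * ((1 - wake p) / D_p p * u) ^+ i.

Definition speed (u v : R) : R := Num.sqrt (u ^+ 2 + v ^+ 2).

Definition X_H (u v r : R) : R := X_uu p * u ^+ 2 + X_bc p * v * r.

Definition Y_H (u v r : R) : R :=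
  Y_b p * u * v + Y_c p * u * r + Y_bb p * v * `|v| + Y_cc p * r * `|r|
  + Y_b_absc p * v * `|r| + Y_absb_c p * `|v| * r
  + Y_ab p * u ^+ 3 * `|v| * v * speed u v ^- 3.

Definition N_H (u v r : R) : R :=
  N_b p * u * v + N_c p * u * r + N_uc p * u * `|r| * r * (speed u v)^-1
  + N_cc p * r * `|r| + N_bb p * v * `|v|
  + N_bbc p * r * v ^+ 2 * (speed u v)^-1
  + N_bcc p * v * r ^+ 2 * (speed u v)^-1
  + N_ab p * u * v ^+ 3 * speed u v ^- 2.

Definition colvec4 (a b c d : R) : 'cV[R]_4 := \col_i [:: a; b; c; d]`_i.

Definition mx4 (rows : seq (seq R)) : 'M[R]_4 :=
  \matrix_(i, j) (nth [::] rows i)`_j.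

Definition mass_mx : 'M[R]_4 := mx4
  [:: [:: mass p + m_uu p; 0; 0; 0];
      [:: 0; mass p + m_vv p; m_vr p; 0];
      [:: 0; m_rv p; I_z p + m_rr p; 0];
      [:: 0; 0; 0; 1]].

(* The right-hand side of M (u, v, r, psi)' = ..., with e = (eps_r, eps_psi). *)
Definition rhs (xT : R) (e : R * R) (z : 'cV[R]_4) : 'cV[R]_4 :=
  let u := z 0 0 in let v := z 1 0 in
  let r := z 2 0 in let psi := z 3 0 in
  let eta := e.1 * r + e.2 * psi in
  colvec4 (mass p * v * r + X_H u v r + tau u * cos eta)
          (- mass p * u * r + Y_H u v r + tau u * sin eta)
          (N_H u v r + xT * tau u * sin eta)
          r.

Definition straight_motion (u0 : R) : Prop :=
  unique (fun u => 0 < u /\ X_uu p * u ^+ 2 + tau u = 0) u0.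

Variable u0 : R.

Definition equilibrium : 'cV[R]_4 := colvec4 u0 0 0 0.

Definition J_mx (xT : R) (e : R * R) : 'M[R]_4 := mx4
  [:: [:: 2 * X_uu p * u0 + derive1 tau u0; 0; 0; 0];
      [:: 0; Y_b p * u0; (Y_c p - mass p) * u0 + tau u0 * e.1; tau u0 * e.2];
      [:: 0; N_b p * u0; N_c p * u0 + xT * tau u0 * e.1; xT * tau u0 * e.2];
      [:: 0; 0; 1; 0]].

Definition A_mx (xT : R) (e : R * R) : 'M[R]_4 :=
  invmx mass_mx *m J_mx xT e.

Definition S_mx (xT : R) (e : R * R) : 'M[R]_3 :=
  @ulsubmx R 3 1 3 1 (A_mx xT e).

Definition Ddet : R :=
  (mass p + m_vv p) * (I_z p + m_rr p) - m_rv p * m_vr p.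

Definition k20 : R := Ddet^-1 * m_rv p * tau u0.
Definition k21 : R := Ddet^-1 * (mass p + m_vv p) * tau u0.
Definition k10 : R := - Ddet^-1 * N_b p * u0 * tau u0.
Definition k11 : R := - Ddet^-1 * Y_b p * u0 * tau u0.
Definition k02 : R :=
  Ddet^-1 * (m_vr p * N_b p - (I_z p + m_rr p) * Y_b p
             - (mass p + m_vv p) * N_c p + m_rv p * (Y_c p - mass p)) * u0.
Definition k01 : R :=
  - Ddet^-1 * (mass p * N_b p + N_c p * Y_b p - N_b p * Y_c p) * u0 ^+ 2.

Definition xT1 : R := k10 / k11.
Definition xT2 : R := k20 / k21.
Definition xTs : R := (k01 * k20 + k02 * k10) / (k01 * k21 + k02 * k11).

Definition c0 (xT : R) (e : R * R) : R := (k10 - k11 * xT) * e.2.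
Definition c1 (xT : R) (e : R * R) : R :=
  - k01 + (k10 - k11 * xT) * e.1 + (k20 - k21 * xT) * e.2.
Definition c2 (xT : R) (e : R * R) : R := k02 + (k20 - k21 * xT) * e.1.

Definition curveC (xT : R) : set (R * R) :=
  [set e | c1 xT e * c2 xT e = c0 xT e].

(* Only meaningful for xT != xT2; the denominator vanishes at xT2. *)
Definition eps_r_star (xT : R) : R :=
  (k10 - k02 * k20 - (k11 - k02 * k21) * xT) / (k20 - k21 * xT) ^+ 2.

Definition quadrant : set (R * R) := [set e | 0 <= e.1 /\ 0 <= e.2].

Definition ceigenvalue n (B : 'M[R]_n) (z : R[i]) : bool :=
  eigenvalue (map_mx (real_complex R) B) z.

Definition hurwitz n (B : 'M[R]_n) : Prop :=
  forall z : R[i], ceigenvalue B z -> complex.Re z < 0.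

Definition stabilized (xT : R) (e : R * R) : Prop :=
  if e.2 == 0 then hurwitz (S_mx xT e) else hurwitz (A_mx xT e).

Definition stability_region (xT : R) : set (R * R) :=
  [set e | quadrant e /\ stabilized xT e].

(* Boundary relative to the closed quadrant. *)
Definition stability_boundary (xT : R) : set (R * R) :=
  closure (stability_region xT) `&`
  closure (quadrant `\` stability_region xT).

Definition critical_eigenvalue (xT : R) (e : R * R) (z : R[i]) : Prop :=
  complex.Re z = 0 /\
  if e.2 == 0 then ceigenvalue (S_mx xT e) z else ceigenvalue (A_mx xT e) z.

End Model.

Section Shapes.
Variable R : realType.

Definition graph_over (D : set R) (g : R -> R) : set (R * R) :=
  [set e | D e.1 /\ e.2 = g e.1].

Definition strictly_monotone_on (D : set R) (g : R -> R) : Prop :=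
  (forall x y, D x -> D y -> x < y -> g x < g y) \/
  (forall x y, D x -> D y -> x < y -> g y < g x).

Definition monotone_graph (B : set (R * R)) (D : set R) (g : R -> R) : Prop :=
  [/\ is_interval D, (exists x y, [/\ D x, D y & x < y]),
      strictly_monotone_on D g & B = graph_over D g].

Definition vertical_line (B : set (R * R)) : Prop :=
  exists x0, B = [set e | e.1 = x0 /\ 0 <= e.2].

Definition meets_r_axis (B : set (R * R)) : Prop := exists x, B (x, 0).
Definition meets_psi_axis (B : set (R * R)) : Prop := exists y, B (0, y).

Definition vertical_asymptote (D : set R) (g : R -> R) (a : R) : Prop :=
  [/\ ~ D a, closure D a & g x @[x --> within D (nbhs a)] --> +oo].

Definition strictly_concave_on (x0 x1 : R) (g : R -> R) : Prop :=
  forall x y t, x0 <= x -> x < y -> y <= x1 -> 0 < t -> t < 1 ->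
    t * g x + (1 - t) * g y < g (t * x + (1 - t) * y).

(* A strictly concave arch over [x0, x1] with feet on the horizontal axis and
   a single vertex. *)
Definition parabolic_arch (x0 x1 : R) (g : R -> R) : Prop :=
  [/\ g x0 = 0, g x1 = 0, (forall x, x0 < x < x1 -> 0 < g x),
      strictly_concave_on x0 x1 g &
      exists2 xm, x0 < xm < x1 &
        (forall x y, x0 <= x -> x < y -> y <= xm -> g x < g y) /\
        (forall x y, xm <= x -> x < y -> y <= x1 -> g y < g x)].

(* Nonzero elements of the Bouligand tangent cone of B at e; at an interior
   point of a regular curve these are its tangent vectors, at an end point
   those pointing into the curve. *)
Definition tangent_vector (B : set (R * R)) (e w : R * R) : Prop :=
  w <> (0, 0) /\
  exists (q : nat -> R * R) (h : nat -> R),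
    [/\ forall n, B (q n) /\ 0 < h n, q n @[n --> \oo] --> e,
        ((q n).1 - e.1) / h n @[n --> \oo] --> w.1 &
        ((q n).2 - e.2) / h n @[n --> \oo] --> w.2].

Definition lin_indep (v w : R * R) : Prop :=
  forall a b : R, a * v.1 + b * w.1 = 0 -> a * v.2 + b * w.2 = 0 ->
    a = 0 /\ b = 0.

(* lam follows an eigenvalue of the matrices B s through z at s0. *)
Definition eigenbranch n (B : R -> 'M[R]_n) (s0 : R) (z : R[i])
    (lam : R -> R[i]) : Prop :=
  [/\ lam s0 = z, \forall s \near s0, ceigenvalue (B s) (lam s),
      {for s0, continuous (fun s => complex.Re (lam s))} &
      {for s0, continuous (fun s => complex.Im (lam s))}].

Definition nonzero_Re_speed (lam : R -> R[i]) (s0 : R) : Prop :=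
  exists2 d : R, d != 0 & is_derive s0 1 (fun s => complex.Re (lam s)) d.

(* Every eigenvalue branch through z moves with nonzero real speed. *)
Definition moves_across n (B : R -> 'M[R]_n) (s0 : R) (z : R[i]) : Prop :=
  (exists lam, eigenbranch B s0 z lam) /\
  forall lam, eigenbranch B s0 z lam -> nonzero_Re_speed lam s0.

Definition crosses_downward (f : R -> R) (s0 : R) : Prop :=
  [/\ f s0 = 0, \forall s \near s0^'-, 0 < f s &
      \forall s \near s0^'+, f s < 0].

End Shapes.

Section Facts.
Variables (R : realType) (p : params R) (u0 : R).

(* At xT = xT2 the curve is the straight line
   eps_psi = k02 * (eps_r - k01 / (k10 - k11 * xT2)), which has slope k02 and
   a negative intercept, so steep rays from the origin miss it. *)
Lemma ray_misses_curveC (er ep s : R) :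
  0 < k21 p u0 -> 0 < k11 p u0 -> 0 < k02 p u0 -> 0 < k01 p u0 ->
  xT2 p u0 < xT1 p u0 -> k02 p u0 * er <= ep -> 0 <= s ->
  ~ curveC p u0 (xT2 p u0) (s * er, s * ep).
Proof.
move=> k21p k11p k02p k01p lt21 steep s0.
rewrite /curveC /= /c1 /c2 /c0 /=.
have -> : k20 p u0 - k21 p u0 * xT2 p u0 = 0.
  by rewrite /xT2 mulrC divfK ?subrr // gt_eqF.
have : 0 < k10 p u0 - k11 p u0 * xT2 p u0.
  by rewrite subr_gt0 mulrC -ltr_pdivlMr.
move: (k10 p u0 - _) => a a0 E.
have h1 : 0 <= a * s * (ep - k02 p u0 * er).
  by apply: mulr_ge0; [apply: mulr_ge0 => //; exact: ltW|rewrite subr_ge0].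
have h2 : 0 < k01 p u0 * k02 p u0 by apply: mulr_gt0.
nra.
Qed.

Lemma equilibriumP (xT : R) (e : R * R) :
  straight_motion p u0 -> rhs p xT e (equilibrium u0) = 0.
Proof.
move=> [[_ E] _]; apply/colP => i; rewrite /rhs /equilibrium !mxE /=.
rewrite !(mulr0, mul0r, addr0, cos0, sin0) /X_H /Y_H /N_H.
case: i => -[|[|[|[|//]]]] ? /=;
  by rewrite ?normr0 ?expr0n /= ?(mulr0, mul0r, addr0, add0r) ?mulr1.
Qed.

Let is_derive_mul0 (k : R -> R) :
  {for 0, continuous k} -> is_derive (0 : R) 1 (fun h => h * k h) (k 0).
Proof.
move=> /continuous_withinNx ck.
have H : h^-1 *: (((fun h => h * k h) \o shift 0) (h *: 1) - 0 * k 0)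
   @[h --> (0:R)^'] --> k 0.
  apply: cvg_trans ck; apply: near_eq_cvg; near=> h.
  rewrite /= addr0 mul0r subr0 /GRing.scale /= mulr1 mulrA mulVf ?mul1r //.
  by near: h; exact: nbhs_dnbhs_neq.
split; first by apply/cvg_ex; exists (k 0); exact: H.
by apply: cvg_lim => //; exact: H.
Unshelve. all: by end_near.
Qed.

Let is_derive_line (F : 'cV[R]_4 -> R) (x v : 'cV[R]_4) (d : R) :
  is_derive (0 : R) 1 (fun h => F (h *: v + x)) d -> is_derive x v F d.
Proof.
have E : (fun h : R => h^-1 *: (((fun h => F (h *: v + x)) \o shift 0) (h *: 1)
    - F (0 *: v + x))) = (fun h => h^-1 *: ((F \o shift x) (h *: v) - F x)).
  by apply/funext => h; rewrite /= addr0 scale0r add0r /GRing.scale /= mulr1.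
case=> [D V]; split; first by move: D; rewrite /derivable E.
by move: V; rewrite /derive E.
Qed.

Let is_derive_sin (k : R -> R) (c a : R) : {for 0, continuous k} ->
  is_derive (0 : R) 1 (fun h => h * k h + c * sin (a * h)) (k 0 + c * a).
Proof.
move=> ck; have := is_derive_mul0 ck => ?.
apply: is_derive_eq.
by rewrite /GRing.scale /= !(mulr0, cos0, mul1r, mulr1, addr0).
Qed.

Let is_derive_cos (b c a : R) :
  is_derive (0 : R) 1 (fun h => b + c * cos (a * h)) 0.
Proof.
apply: is_derive_eq.
by rewrite /GRing.scale /= !(mulr0, sin0, mul1r, mulr1, addr0, mul0r, oppr0).
Qed.

Let derivable_tau (u : R) : derivable (tau p) u 1.
Proof.
pose q : {poly R} := (2 * (1 - thrust_deduction p) * (L_pp p / draft p) *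
  D_p p ^+ 4)%:P * \sum_(i < 6) (K_T p i)%:P * (((1 - wake p) / D_p p)%:P * 'X) ^+ i.
have -> : tau p = horner q by apply/funext => v; rewrite /tau /q !hornerE_comm horner_sum;
  congr (_ * _); apply: eq_bigr => i _; rewrite !hornerE.
exact: derivable_horner.
Qed.

Let is_derive_u : is_derive (0 : R) 1
  (fun h => X_uu p * (h + u0) ^+ 2 + tau p (h + u0))
  (2 * X_uu p * u0 + derive1 (tau p) u0).
Proof.
have Dt : is_derive (0 + u0) 1 (tau p) (derive1 (tau p) u0).
  by rewrite add0r derive1E; apply/derivableP/derivable_tau.
have Ds : is_derive (0 : R) 1 (fun h => h + u0) 1.
  by apply: is_derive_eq; rewrite addr0.
have Dc : is_derive (0 : R) 1 (fun h => tau p (h + u0)) (derive1 (tau p) u0).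
  by have := @is_derive1_comp R (tau p) _ 0 _ _ Dt Ds; rewrite mulr1.
apply: is_derive_eq.
by rewrite /GRing.scale /= add0r; ring.
Qed.

Let cvg_speedV : 0 < u0 -> {for 0, continuous (fun h => (speed u0 h)^-1)}.
Proof.
move=> u0p; apply: cvgV.
  by rewrite /speed gt_eqF // sqrtr_gt0 expr0n /= addr0 exprn_gt0.
apply: continuous_comp; last exact: sqrt_continuous.
apply: cvgD; first exact: cvg_cst.
exact: exprn_continuous.
Qed.

Let is_derive_gen (a b c d t s : R) : 0 < u0 ->
  is_derive (0 : R) 1
    (fun h => h * (a + b * `|h| + c * (`|h| * (speed u0 h)^-1 ^+ 3)
                   + d * (h ^+ 2 * (speed u0 h)^-1 ^+ 2)) + t * sin (s * h))
    (a + t * s).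
Proof.
move=> u0p; have wc := cvg_speedV u0p.
have nc : {for 0, continuous (fun h : R => `|h|)} by exact: norm_continuous.
have wX n : {for 0, continuous (fun h : R => (speed u0 h)^-1 ^+ n)}.
  apply: (@continuous_comp _ _ _ (fun h => (speed u0 h)^-1)
    (fun x : R => x ^+ n) 0 wc).
  exact: exprn_continuous.
pose k h := a + b * `|h| + c * (`|h| * (speed u0 h)^-1 ^+ 3)
            + d * (h ^+ 2 * (speed u0 h)^-1 ^+ 2).
have -> : a + t * s = k 0 + t * s.
  by rewrite /k normr0 expr0n /= !(mul0r, mulr0, addr0).
suff ck : {for 0, continuous k} by exact: (is_derive_sin t s ck).
rewrite /k.
apply: cvgD; last first.
  by apply: cvgM; [exact: cvg_cst|apply: cvgM; [exact: exprn_continuous|exact: wX]].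
apply: cvgD; last first.
  by apply: cvgM; [exact: cvg_cst|apply: cvgM; [exact: nc|exact: wX]].
by apply: cvgD; [exact: cvg_cst|apply: cvgM; [exact: cvg_cst|exact: nc]].
Qed.

Let is_derive_congr (f g : R -> R) (d d' : R) :
  is_derive (0 : R) 1 g d' -> f =1 g -> d = d' -> is_derive (0 : R) 1 f d.
Proof. by move=> H /funext -> ->. Qed.

Lemma J_mx_partial (xT : R) (e : R * R) (i j : 'I_4) : 0 < u0 ->
  is_derive (equilibrium u0) (delta_mx j 0 : 'cV[R]_4)
    (fun z => rhs p xT e z i 0) (J_mx p u0 xT e i j).
Proof.
move=> u0p; apply: is_derive_line.
have simpE := (mulr0, mul0r, addr0, add0r, mulr1, cos0, sin0, normr0).
have speed0 : speed u0 0 = u0.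
  by rewrite /speed expr0n addr0 sqrtr_sqr gtr0_norm.
have gen a b c d t s := is_derive_gen a b c d t s u0p.
have EF h : rhs p xT e (h *: delta_mx j 0 + equilibrium u0) i 0 =
  let u := h * (j == 0)%:R + u0 in let v := h * (j == 1)%:R in
  let r := h * (j == 2)%:R in let psi := h * (j == 3)%:R in
  let eta := e.1 * r + e.2 * psi in
  [:: mass p * v * r + X_H p u v r + tau p u * cos eta;
      - mass p * u * r + Y_H p u v r + tau p u * sin eta;
      N_H p u v r + xT * tau p u * sin eta;
      r]`_i.
  by rewrite /rhs !mxE /= !addr0 !(eq_sym j) !andbT.
rewrite (funext EF) => {EF}.
case: i => -[|[|[|[|//]]]] ?; case: j => -[|[|[|[|//]]]] ?;
  rewrite /X_H /Y_H /N_H !mxE /=.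
- apply: (is_derive_congr is_derive_u) => // h.
  by rewrite !simpE.
- apply: (is_derive_congr (is_derive_cos (X_uu p * u0 ^+ 2) (tau p u0) 0)) => // h.
  by rewrite !simpE.
- apply: (is_derive_congr (is_derive_cos (X_uu p * u0 ^+ 2) (tau p u0) e.1)) => // h.
  by rewrite !simpE.
- apply: (is_derive_congr (is_derive_cos (X_uu p * u0 ^+ 2) (tau p u0) e.2)) => // h.
  by rewrite !simpE.
- apply: (is_derive_congr (gen 0 0 0 0 0 0)) => [h|]; by rewrite ?simpE.
- apply: (is_derive_congr (gen (Y_b p * u0) (Y_bb p) (Y_ab p * u0 ^+ 3) 0 0 0))
    => [h|]; rewrite ?simpE // -exprVn; ring.
- apply: (is_derive_congr (gen ((Y_c p - mass p) * u0) (Y_cc p) 0 0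
    (tau p u0) e.1)) => [h|]; rewrite ?simpE //; ring.
- apply: (is_derive_congr (gen 0 0 0 0 (tau p u0) e.2)) => [h|]; by rewrite ?simpE.
- apply: (is_derive_congr (gen 0 0 0 0 0 0)) => [h|];
    by rewrite ?simpE ?expr0n /= ?simpE.
- apply: (is_derive_congr (gen (N_b p * u0) (N_bb p) 0 (N_ab p * u0) 0 0))
    => [h|]; rewrite ?simpE ?expr0n /= ?simpE // -exprVn; ring.
- apply: (is_derive_congr (gen (N_c p * u0) (N_uc p + N_cc p) 0 0
    (xT * tau p u0) e.1)) => [h|]; rewrite ?simpE ?expr0n /= ?simpE // speed0.
  by field; rewrite gt_eqF.
- apply: (is_derive_congr (gen 0 0 0 0 (xT * tau p u0) e.2)) => [h|];
    by rewrite ?simpE ?expr0n /= ?simpE.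
- apply: (is_derive_congr (gen 0 0 0 0 0 0)) => [h|] /=;
    by rewrite ?simpE.
- apply: (is_derive_congr (gen 0 0 0 0 0 0)) => [h|] /=;
    by rewrite ?simpE.
- apply: (is_derive_congr (gen 1 0 0 0 0 0)) => [h|] /=;
    by rewrite ?simpE.
- apply: (is_derive_congr (gen 0 0 0 0 0 0)) => [h|] /=;
    by rewrite ?simpE.
Qed.

End Facts.

(* Main.v *)
(* Idea. The characteristic polynomial of A is (X - s) times a real cubic
   X^3 + c2 X^2 + c1 X + c0 whose coefficients are affine in the gains, and
   s < 0. By Routh-Hurwitz, stability in the quadrant means c2 > 0,
   a := k10 - k11 xT > 0 (when eps_psi > 0) and F := c1 c2 - c0 > 0. Writing
   b := k20 - k21 xT, some gain is stabilizing only if a > 0 and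
   a k02 + b k01 > 0, and then the stability boundary is the part of {F = 0}
   with c2 >= 0. As F is affine in eps_psi, this is a graph or a vertical line,
   and its shape is read off the explicit slope of the graph.
   If two roots of the cubic sum to -P, then P (c1 + (c2 - P)^2) = F. Near a
   purely imaginary pair the factor of P stays positive, so the real part -P/2
   has the sign and the order of vanishing of -F along any curve of gains. A
   transversal curve has a nonzero derivative of F because grad F <> 0 on the
   boundary, while tangent vectors annihilate it. *)
Require Import Defs.
From HB Require Import structures.
From mathcomp Require Import all_boot all_order all_algebra.
From mathcomp Require Import all_classical all_reals all_analysis.
From mathcomp Require Import complex.
From mathcomp Require Import ring lra.

Set Implicit Arguments.
Unset Strict Implicit.
Unset Printing Implicit Defensive.

Import Order.TTheory GRing.Theory Num.Theory.
Import numFieldNormedType.Exports.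

Local Open Scope classical_set_scope.
Local Open Scope ring_scope.

(** * Characteristic polynomials *)

(** On the axis [e.2 = 0] stability is judged by [S], because [A] keeps the eigenvalue 0 there. The
    Routh function absorbs this change: it reduces to [c1 * c2], so the same inequalities serve both
    cases. The quantity [a k + b l] is [a] times the value of [c2] at the point [l / a] of the axis
    where [c1] vanishes; its positivity keeps [c1] and [c2] from vanishing together on the axis.
    Curves of gains are only assumed differentiable at the crossing point, so the implicit function
    theorem does not apply to the roots. The sum of a pair is obtained instead from the intermediate
    value theorem and a uniform slope bound, and derivatives of real parts from an identity
    [P D = H] in which [D] is merely continuous. The delicate point is the one on the axis with
    [c1 = 0]. There [A] has a double eigenvalue 0, whose branches would split like square roots if
    [c0] vanished only to first order. A curve inside the quadrant must touch the axis, so [c0] has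
    zero derivative; given a second derivative, [c0] is quadratically small and the rescaled
    quadratic factor is regular. *)

Lemma det_mx3 (K : comNzRingType) (B : 'M[K]_3) : \det B =
  B 0 0 * (B 1 1 * B 2 2 - B 1 2 * B 2 1)
  - B 0 1 * (B 1 0 * B 2 2 - B 1 2 * B 2 0)
  + B 0 2 * (B 1 0 * B 2 1 - B 1 1 * B 2 0).
Proof.
rewrite (expand_det_row _ 0) !big_ord_recl big_ord0 /cofactor.
rewrite !(expand_det_row _ (0 : 'I_2)) !big_ord_recl !big_ord0 /cofactor.
rewrite !det_mx11 !mxE.
(* Indexing by natural numbers lets the ordinals produced by the cofactor expansion compute, so that
   [ring] recognizes equal entries. *)
have [f E] : exists f : nat -> nat -> K, forall i j, B i j = f (val i) (val j).
  by exists (fun i j => B (inord i) (inord j)) => i j; rewrite !inord_val.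
by rewrite !E /= /bump /=; ring.
Qed.

Section Spectrum.
Variables (R : realType) (p : params R) (u0 xT : R) (e : R * R).
Hypotheses (M_unit : mass_mx p \in unitmx) (m_pos : 0 < mass p + m_uu p).
Hypothesis k21_pos : 0 < k21 p u0.

Definition surge_eig : R :=
  (2 * X_uu p * u0 + derive1 (tau p) u0) / (mass p + m_uu p).

Let iD := (Ddet p)^-1.
Let m22 := mass p + m_vv p.
Let m33 := I_z p + m_rr p.
(** [row1] and [row2] are the rows of the inverse of the sway-yaw block of the mass matrix, applied
    to a column with entries [y], [z]. *)
Let row1 (y z : R) := iD * (m33 * y - m_vr p * z).
Let row2 (y z : R) := iD * (m22 * z - m_rv p * y).
Let j12 := (Y_c p - mass p) * u0 + tau p u0 * e.1.
Let j22 := N_c p * u0 + xT * tau p u0 * e.1.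
Let j13 := tau p u0 * e.2.
Let j23 := xT * tau p u0 * e.2.

(** With a zero determinant the convention [0^-1 = 0] would force [k21 = 0]. *)
Lemma Ddet_neq0 : Ddet p != 0.
Proof.
by apply: contraTneq k21_pos => E; rewrite /k21 E invr0 !mul0r ltxx.
Qed.

Lemma A_mxE : A_mx p u0 xT e = mx4
  [:: [:: surge_eig; 0; 0; 0];
      [:: 0; row1 (Y_b p * u0) (N_b p * u0); row1 j12 j22; row1 j13 j23];
      [:: 0; row2 (Y_b p * u0) (N_b p * u0); row2 j12 j22; row2 j13 j23];
      [:: 0; 0; 1; 0]].
Proof.
have D0 := Ddet_neq0; have m0 := lt0r_neq0 m_pos.
(* Moving the mass matrix to the other side avoids computing its inverse. *)
rewrite /A_mx; apply: (canLR (mulKmx M_unit)).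
apply/matrixP => i j; rewrite !mxE.
rewrite !big_ord_recl big_ord0 !mxE /=.
case: i => -[|[|[|[|//]]]] ?; case: j => -[|[|[|[|//]]]] ? /=;
  rewrite /row1 /row2 /surge_eig /iD ?(mulr0, mul0r, addr0, add0r, mul1r) //;
  move: D0; rewrite /Ddet /m22 /m33 /j12 /j22 /j13 /j23 => D0; field.
all: done.
Qed.

Let tr_block : c2 p u0 xT e = - (row1 (Y_b p * u0) (N_b p * u0) + row2 j12 j22).
Proof. by rewrite /c2 /k02 /k20 /k21 /row1 /row2 /j12 /j22 /m22 /m33 /iD; ring. Qed.

Let minors_block : c1 p u0 xT e =
  row1 (Y_b p * u0) (N_b p * u0) * row2 j12 j22
  - row1 j12 j22 * row2 (Y_b p * u0) (N_b p * u0) - row2 j13 j23.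
Proof.
have := Ddet_neq0.
rewrite /c1 /k01 /k10 /k11 /k20 /k21 /row1 /row2 /j12 /j22 /j13 /j23 /iD.
by rewrite /Ddet /m22 /m33 => D0; field.
Qed.

Let det_block : c0 p u0 xT e = row1 (Y_b p * u0) (N_b p * u0) * row2 j13 j23
  - row1 j13 j23 * row2 (Y_b p * u0) (N_b p * u0).
Proof.
have := Ddet_neq0.
rewrite /c0 /k10 /k11 /row1 /row2 /j13 /j23 /iD.
by rewrite /Ddet /m22 /m33 => D0; field.
Qed.

Lemma char_poly_A : char_poly (A_mx p u0 xT e) =
  ('X - surge_eig%:P) * ('X ^+ 3 + (c2 p u0 xT e)%:P * 'X ^+ 2
    + (c1 p u0 xT e)%:P * 'X + (c0 p u0 xT e)%:P).
Proof.
rewrite tr_block minors_block det_block A_mxE /char_poly /char_poly_mx.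
move: (row1 (Y_b p * u0) _) (row1 j12 _) (row1 j13 _) => a11 a12 a13.
move: (row2 (Y_b p * u0) _) (row2 j12 _) (row2 j13 _) => a21 a22 a23.
rewrite (expand_det_row _ 0) !big_ord_recl big_ord0 /cofactor !mxE /=.
rewrite !(mulr0n, mulr1n, subr0, sub0r, oppr0, mul0r, addr0, polyC0, expr0, mul1r).
congr (_ * _).
rewrite det_mx3 !mxE /=.
rewrite !(mulr0n, mulr1n, subr0, sub0r, oppr0, mul0r, addr0, polyC0, polyC1).
rewrite !(polyCN, polyCD, polyCM); ring.
Qed.

Lemma char_poly_S : e.2 = 0 -> char_poly (S_mx p u0 xT e) =
  ('X - surge_eig%:P) * ('X ^+ 2 + (c2 p u0 xT e)%:P * 'X
    + (c1 p u0 xT e)%:P).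
Proof.
move=> e20.
have j23_0 : row2 j13 j23 = 0 by rewrite /row2 /j13 /j23 e20; ring.
rewrite tr_block minors_block j23_0.
rewrite /S_mx A_mxE /char_poly /char_poly_mx.
move: (row1 (Y_b p * u0) _) (row1 j12 _) (row1 j13 _) => a11 a12 a13.
move: (row2 (Y_b p * u0) _) (row2 j12 _) (row2 j13 _) => a21 a22 a23.
rewrite det_mx3 !mxE /=.
rewrite !(mulr0n, mulr1n, subr0, sub0r, oppr0, mul0r, addr0, polyC0, polyC1).
rewrite !(polyCN, polyCD, polyCM, polyCB); ring.
Qed.

Lemma eigenvalue0_A : e.2 = 0 -> eigenvalue (A_mx p u0 xT e) 0.
Proof.
move=> e20; rewrite eigenvalue_root_char char_poly_A /root !hornerE /c0 e20.
by rewrite !mulr0 !expr0n /= !mulr0 !addr0 mulr0.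
Qed.
End Spectrum.

Section ComplexRoots.
Variable R : realType.
Implicit Types (p q x y : R).

(* Real and imaginary parts of z ^+ 2 + p z + q = 0 at z = x + i y, and of its
   cubic analogue. *)
Definition quad_root p q x y :=
  x ^+ 2 - y ^+ 2 + p * x + q = 0 /\ (2 * x + p) * y = 0.

Definition cubic_root (d2 d1 d0 : R) x y :=
  x ^+ 3 - 3 * x * y ^+ 2 + d2 * (x ^+ 2 - y ^+ 2) + d1 * x + d0 = 0 /\
  (3 * x ^+ 2 - y ^+ 2 + 2 * d2 * x + d1) * y = 0.

Lemma ceigenvalueE n (B : 'M[R]_n) (z : R[i]) :
  ceigenvalue B z = ((map_poly (real_complex R) (char_poly B)).[z] == 0).
Proof. by rewrite /ceigenvalue eigenvalue_root_char -map_char_poly. Qed.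

Lemma complex_eq0P x y : ((x +i* y)%C == 0 :> R[i]) <-> x = 0 /\ y = 0.
Proof.
by rewrite eq_complex /=; split=> [/andP[/eqP-> /eqP->]|[-> ->]]; rewrite ?eqxx.
Qed.

Lemma char_quadP n (B : 'M[R]_n) s p q x y :
  char_poly B = ('X - s%:P) * ('X ^+ 2 + p%:P * 'X + q%:P) ->
  ceigenvalue B (x +i* y)%C <-> (x = s /\ y = 0) \/ quad_root p q x y.
Proof.
rewrite ceigenvalueE => ->.
rewrite rmorphM rmorphB !rmorphD (rmorphM _ p%:P) /= map_polyXn !map_polyX !map_polyC.
rewrite !hornerE /= mulf_eq0.
have -> : ((x +i* y) - real_complex R s = (x - s) +i* y)%C.
  by apply/eqP; rewrite eq_complex /= subr0 !eqxx.
have -> : ((x +i* y) ^+ 2 + real_complex R p * (x +i* y) + real_complex R q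
  = (x ^+ 2 - y ^+ 2 + p * x + q) +i* ((2 * x + p) * y))%C.
  by apply/eqP; rewrite eq_complex /=; apply/andP; split; apply/eqP; ring.
split=> [/orP[/complex_eq0P[/eqP]|/complex_eq0P]|[[-> ->]|]].
- by rewrite subr_eq0 => /eqP -> ->; left.
- by right.
- by rewrite subrr; apply/orP; left; apply/complex_eq0P.
- by move=> H; apply/orP; right; apply/complex_eq0P.
Qed.

Lemma char_cubicP n (B : 'M[R]_n) s (d2 d1 d0 : R) x y :
  char_poly B = ('X - s%:P) * ('X ^+ 3 + d2%:P * 'X ^+ 2 + d1%:P * 'X + d0%:P) ->
  ceigenvalue B (x +i* y)%C <-> (x = s /\ y = 0) \/ cubic_root d2 d1 d0 x y.
Proof.
rewrite ceigenvalueE => ->.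
rewrite rmorphM rmorphB !rmorphD (rmorphM _ d2%:P) (rmorphM _ d1%:P) /=.
rewrite !map_polyXn !map_polyX !map_polyC.
rewrite !hornerE /= mulf_eq0.
have -> : ((x +i* y) - real_complex R s = (x - s) +i* y)%C.
  by apply/eqP; rewrite eq_complex /= subr0 !eqxx.
have -> : ((x +i* y) ^+ 3 + real_complex R d2 * (x +i* y) * (x +i* y)
    + real_complex R d1 * (x +i* y) + real_complex R d0
  = (x ^+ 3 - 3 * x * y ^+ 2 + d2 * (x ^+ 2 - y ^+ 2) + d1 * x + d0)
    +i* ((3 * x ^+ 2 - y ^+ 2 + 2 * d2 * x + d1) * y))%C.
  by apply/eqP; rewrite eq_complex /=; apply/andP; split; apply/eqP; ring.
split=> [/orP[/complex_eq0P[/eqP]|/complex_eq0P]|[[-> ->]|]].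
- by rewrite subr_eq0 => /eqP -> ->; left.
- by right.
- by rewrite subrr; apply/orP; left; apply/complex_eq0P.
- by move=> H; apply/orP; right; apply/complex_eq0P.
Qed.

End ComplexRoots.

(** * Routh-Hurwitz criterion *)

Section RouthHurwitz.
Variable R : realType.
Implicit Types (p q x y : R).

Lemma quad_hurwitz p q :
  (forall x y, quad_root p q x y -> x < 0) <-> 0 < p /\ 0 < q.
Proof.
split=> [H|[p0 q0] x y [Ex Ey]]; last first.
  rewrite ltNge; apply/negP => x0.
  have y0 : y = 0 by move/eqP: Ey; rewrite mulf_eq0 => /orP[|] /eqP; nra.
  by move: Ex; rewrite y0; nra.
(* Only a root of largest real part is tested. If the roots are real, [- p / 2 + t < 0] with
   [t >= 0] gives both signs; otherwise the real part is [- p / 2], and [q > p^2 / 4] is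
   automatic. *)
have [d|d] := leP 0 (p ^+ 2 / 4 - q).
  pose t := Num.sqrt (p ^+ 2 / 4 - q).
  have t2 : t ^+ 2 = p ^+ 2 / 4 - q by rewrite sqr_sqrtr.
  have t0 : 0 <= t by apply: sqrtr_ge0.
  have /H lt0 : quad_root p q (- p / 2 + t) 0.
    split; last by rewrite mulr0.
    have -> : q = p ^+ 2 / 4 - t ^+ 2 by rewrite t2; ring.
    by field.
  by split; nra.
pose t := Num.sqrt (q - p ^+ 2 / 4).
have t2 : t ^+ 2 = q - p ^+ 2 / 4 by rewrite sqr_sqrtr //; lra.
have /H lt0 : quad_root p q (- p / 2) t.
  split; last by field.
  by rewrite t2; field.
by split; nra.
Qed.

Lemma cubic_real_root (d2 d1 d0 : R) :
  exists r, r ^+ 3 + d2 * r ^+ 2 + d1 * r + d0 = 0.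
Proof.
pose P : {poly R} := 'X ^+ 3 + d2%:P * 'X ^+ 2 + d1%:P * 'X + d0%:P.
have PE r : P.[r] = r ^+ 3 + d2 * r ^+ 2 + d1 * r + d0.
  by rewrite /P !hornerE; ring.
(* A Cauchy bound: [M^3] equals [M^2] plus [M^2] times the sum of the absolute values of the
   coefficients, which dominates the lower terms, so the cubic changes sign on [[-M, M]]. *)
pose M := 1 + (`|d2| + `|d1| + `|d0|).
have M1 : 1 <= M by rewrite lerDl !addr_ge0.
have M2 : M <= M ^+ 2 by nra.
have [a2 b2] : - `|d2| <= d2 /\ d2 <= `|d2| by split; [exact: lerNnormlW|exact: ler_norm].
have [a1 b1] : - `|d1| <= d1 /\ d1 <= `|d1| by split; [exact: lerNnormlW|exact: ler_norm].
have [a0 b0] : - `|d0| <= d0 /\ d0 <= `|d0| by split; [exact: lerNnormlW|exact: ler_norm].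
have n2 := normr_ge0 d2; have n1 := normr_ge0 d1; have n0 := normr_ge0 d0.
have E3 : M ^+ 3 = M ^+ 2 + `|d2| * M ^+ 2 + `|d1| * M ^+ 2 + `|d0| * M ^+ 2.
  by rewrite [LHS]exprS {1}/M; ring.
have [] := @poly_ivt R P (- M) M; first by lra.
  have N3 : (- M) ^+ 3 = - M ^+ 3 by ring.
  rewrite !PE; apply/andP; split; first by rewrite N3 sqrrN E3; nra.
  by rewrite E3; nra.
by move=> r _ /rootP; rewrite PE; exists r.
Qed.

Lemma cubic_hurwitz (d2 d1 d0 : R) :
  (forall x y, cubic_root d2 d1 d0 x y -> x < 0) <->
  [/\ 0 < d2, 0 < d0 & 0 < d1 * d2 - d0].
Proof.
split=> [H|[d2_0 d0_0 h] x y [Ex Ey]]; last first.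
  have d1_0 : 0 < d1 by nra.
  rewrite ltNge; apply/negP => x0.
  have x2 : 0 <= x ^+ 2 by apply: sqr_ge0.
  have x3 : 0 <= x ^+ 3 by apply: exprn_ge0.
  move/eqP: Ey; rewrite mulf_eq0 => /orP[|] /eqP Ey; last by move: Ex; rewrite Ey; nra.
  (* Eliminating [y^2] leaves a cubic for the real part of a nonreal root. Its coefficients are
     positive, so it has no root [x >= 0]. *)
  have : 8 * x ^+ 3 + 8 * d2 * x ^+ 2 + 2 * (d1 + d2 ^+ 2) * x + (d1 * d2 - d0) = 0.
    by move: Ex; have -> : y ^+ 2 = 3 * x ^+ 2 + 2 * d2 * x + d1; [lra|nra].
  by nra.
have [r Er] := cubic_real_root d2 d1 d0.
(* These are the coefficients of the quotient by [X - r], whose roots are also roots of the cubic.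
   The last Hurwitz condition then reads [d1 d2 - d0 = p (q - p r + r^2)]. *)
pose p := d2 + r; pose q := d1 + p * r.
have r0 : r < 0 by apply: (H r 0); split; [rewrite -[RHS]Er; ring|rewrite mulr0].
have [p0 q0] : 0 < p /\ 0 < q.
  apply/quad_hurwitz => x y [Ex Ey]; apply: (H x y).
  have E0 : d0 = - q * r by rewrite /q /p; nra.
  have E1 : d1 = q - p * r by rewrite /q; ring.
  have E2 : d2 = p - r by rewrite /p; ring.
  split; rewrite ?E0 ?E1 ?E2.
    transitivity ((x - r) * (x ^+ 2 - y ^+ 2 + p * x + q) - y * ((2 * x + p) * y)); first ring.
    by rewrite Ex Ey; ring.
  transitivity ((x - r) * ((2 * x + p) * y) + y * (x ^+ 2 - y ^+ 2 + p * x + q)); first ring.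
  by rewrite Ex Ey; ring.
have E0 : d0 = - q * r by rewrite /q /p; nra.
have E1 : d1 = q - p * r by rewrite /q; ring.
have E2 : d2 = p - r by rewrite /p; ring.
by split; rewrite ?E0 ?E1 ?E2; nra.
Qed.

End RouthHurwitz.

(** The function [F] of the overview, that is, the second Hurwitz determinant of the cubic. *)
Definition routh (R : realType) (p : params R) (u0 xT : R) (e : R * R) : R :=
  c1 p u0 xT e * c2 p u0 xT e - c0 p u0 xT e.

Section Stability.
Variables (R : realType) (p : params R) (u0 xT : R).
Hypotheses (M_unit : mass_mx p \in unitmx) (m_pos : 0 < mass p + m_uu p).
Hypothesis k21_pos : 0 < k21 p u0.
Hypothesis surge_neg : surge_eig p u0 < 0.

Lemma A_eigP (e : R * R) x y : ceigenvalue (A_mx p u0 xT e) (x +i* y)%C <->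
  (x = surge_eig p u0 /\ y = 0) \/
  cubic_root (c2 p u0 xT e) (c1 p u0 xT e) (c0 p u0 xT e) x y.
Proof. exact/char_cubicP/char_poly_A. Qed.

Lemma S_eigP (e : R * R) x y : e.2 = 0 ->
  ceigenvalue (S_mx p u0 xT e) (x +i* y)%C <->
  (x = surge_eig p u0 /\ y = 0) \/
  quad_root (c2 p u0 xT e) (c1 p u0 xT e) x y.
Proof. by move=> e20; exact/char_quadP/char_poly_S. Qed.

(** One criterion covers both definitions of stability: on the axis [c0 = 0], and once [c2 > 0] the
    condition [c1 * c2 > 0] is the remaining condition [c1 > 0] for the quadratic factor of [S]. *)
Lemma stabilizedP (e : R * R) : stabilized p u0 xT e <->
  [/\ 0 < c2 p u0 xT e, 0 < routh p u0 xT e & e.2 != 0 -> 0 < c0 p u0 xT e].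
Proof.
rewrite /stabilized; case: eqP => [e20|e20].
  rewrite /routh; have -> : c0 p u0 xT e = 0 by rewrite /c0 e20 mulr0.
  rewrite subr0; transitivity (0 < c2 p u0 xT e /\ 0 < c1 p u0 xT e); last first.
    by split=> [[? ?]|[c2_0]]; [split; rewrite ?mulr_gt0|rewrite pmulr_lgt0].
  rewrite -quad_hurwitz; split=> [H x y Q|H [x y]].
    by apply: (H (x +i* y)%C); apply/S_eigP => //; right.
  by move/(S_eigP x y e20) => [[-> _]|/H].
transitivity [/\ 0 < c2 p u0 xT e, 0 < c0 p u0 xT e & 0 < routh p u0 xT e].
  rewrite -cubic_hurwitz; split=> [H x y Q|H [x y]].
    by apply: (H (x +i* y)%C); apply/A_eigP; right.
  by move/A_eigP => [[-> _]|/H].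
by split=> [[? ? ?]|[? ? H]]; split=> //; apply: H.
Qed.

End Stability.

(** * Stability region in the gain plane *)

Section GainPlane.
Variables (R : realType) (a b k l : R).
Hypotheses (a_pos : 0 < a) (k_pos : 0 < k) (l_pos : 0 < l).
Hypothesis w_pos : 0 < a * k + b * l.

(** Since the Routh function is affine in the second gain, it is written as [numer x - y * denom x].
    Here [numer] is its restriction to the axis, the product of [c2] and [c1]. *)
Definition numer x := (k + b * x) * (a * x - l).
Definition denom x := a - b * (k + b * x).

Definition gain_region : set (R * R) := [set e |
  [/\ quadrant e, 0 < k + b * e.1 & 0 < numer e.1 - e.2 * denom e.1]].

(** The condition on the trace matters for [b < 0]: the zero set of the Routh function then has
    further points in the quadrant, with negative trace, that do not bound the region. *)
Definition gain_boundary : set (R * R) := [set e |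
  [/\ quadrant e, 0 <= k + b * e.1 & numer e.1 = e.2 * denom e.1]].

Lemma continuous_trace : continuous (fun e : R * R => k + b * e.1).
Proof.
move=> e; apply: cvgD; first exact: cvg_cst.
by apply: cvgM; [exact: cvg_cst|exact: cvg_fst].
Qed.

Lemma continuous_numer : continuous numer.
Proof.
move=> x; apply: cvgM.
  by apply: cvgD; [exact: cvg_cst|apply: cvgM; [exact: cvg_cst|exact: cvg_id]].
by apply: cvgB; [apply: cvgM; [exact: cvg_cst|exact: cvg_id]|exact: cvg_cst].
Qed.

Lemma continuous_denom : continuous denom.
Proof.
move=> x; apply: cvgB; first exact: cvg_cst.
apply: cvgM; first exact: cvg_cst.
by apply: cvgD; [exact: cvg_cst|apply: cvgM; [exact: cvg_cst|exact: cvg_id]].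
Qed.

Lemma continuous_routh : continuous (fun e : R * R => numer e.1 - e.2 * denom e.1).
Proof.
move=> e; apply: cvgB.
  by apply: continuous_comp; [exact: cvg_fst|exact: continuous_numer].
apply: cvgM; first exact: cvg_snd.
by apply: continuous_comp; [exact: cvg_fst|exact: continuous_denom].
Qed.

Lemma closed_ge0 (T : topologicalType) (f : T -> R) :
  continuous f -> closed [set x | 0 <= f x].
Proof.
move=> cf; apply: (@closed_comp _ _ f [set y | 0 <= y]) => [x _|]; first exact: cf.
exact: closed_ge.
Qed.

Lemma closed_quadrant : closed (@quadrant R).
Proof.
have -> : @quadrant R = [set e | 0 <= e.1] `&` [set e | 0 <= e.2].
  by apply/seteqP; split.
by apply: closedI; apply: closed_ge0 => e; [exact: cvg_fst|exact: cvg_snd].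
Qed.

(** Every boundary point will be reached from inside the region along a straight segment. *)
Lemma closure_path (A : set (R * R)) (e v : R * R) :
  (forall t, 0 < t < 1 -> A (e.1 + t * v.1, e.2 + t * v.2)) -> closure A e.
Proof.
move=> H B Be.
pose f (t : R) := (e.1 + t * v.1, e.2 + t * v.2).
have cf : f t @[t --> 0^'+] --> e.
  apply: cvg_at_right_filter.
  have line x w : x + t * w @[t --> (0 : R)] --> x.
    rewrite -[X in _ --> X]addr0 -[in X in _ --> X](mul0r w).
    by apply: cvgD; [exact: cvg_cst|apply: cvgM; [exact: cvg_id|exact: cvg_cst]].
  by case: e @f {H Be} => e1 e2 f; exact: (cvg_pair (line e1 v.1) (line e2 v.2)).
have /(@filter_ex _ (0 : R)^'+ _) [t [At Bt]] : \forall t \near 0^'+, A (f t) /\ B (f t).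
  near=> t; split; last by near: t; exact: cf.
  apply: H; apply/andP; split.
    by near: t; exact: nbhs_right_gt.
  by near: t; apply: nbhs_right_lt.
by exists (f t).
Unshelve. all: by end_near.
Qed.

Lemma gain_boundary_sub :
  closure gain_region `&` closure (@quadrant R `\` gain_region) `<=` gain_boundary.
Proof.
move=> e [cR cN].
have [Qe k0 h0] : [/\ quadrant e, 0 <= k + b * e.1 & 0 <= numer e.1 - e.2 * denom e.1].
  split.
  - apply: closed_quadrant; move: cR; apply: closureS => z [] //.
  - apply: (closed_ge0 continuous_trace); move: cR; apply: closureS => z [_ /ltW] //.
  - by apply: (closed_ge0 continuous_routh); move: cR; apply: closureS => z [_ _ /ltW].
split=> //; apply/eqP; rewrite -subr_eq0 eq_le h0 andbT.
pose N1 : set (R * R) := [set e | 0 <= - (k + b * e.1)].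
pose N2 : set (R * R) := [set e | 0 <= - (numer e.1 - e.2 * denom e.1)].
have cl : closed (N1 `|` N2).
  apply: closedU; apply: closed_ge0 => z; apply: cvgN.
    exact: continuous_trace.
  exact: continuous_routh.
have [] : (N1 `|` N2) e.
- apply: cl; move: cN; apply: closureS => z [Qz nRz]; rewrite /N1 /N2 /= !oppr_ge0.
  have [?|k1] := leP (k + b * z.1) 0; first by left.
  have [?|h1] := leP (numer z.1 - z.2 * denom z.1) 0; first by right.
  by case: nRz.
(* Where the trace vanishes the Routh function equals [- a y], which is nonpositive in the
   quadrant. *)
- rewrite /N1 /= oppr_ge0 => k0'; have {k0'}k0 : k + b * e.1 = 0 by apply/eqP; rewrite eq_le k0'.
  by case: Qe => ? ?; rewrite /numer /denom k0 mul0r mulr0 subr0 sub0r oppr_le0 mulr_ge0 // ltW.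
- by rewrite /N2 /= oppr_ge0.
Qed.

Lemma gain_boundary_closure : gain_boundary `<=` closure gain_region.
Proof.
have := (a_pos, k_pos, l_pos, w_pos) => -[[[a0 kp] lp] w0].
case=> x y [] /= [/= x0 y0] k0 E.
(* The Routh function has constant term [- l k] and, for [b >= 0], a nonnegative quadratic term
   along each ray. Scaling a zero by [1 + t] therefore makes it positive. *)
have [b0|b0] := leP 0 b.
  apply: (@closure_path _ _ (x, y)) => /= t /andP[t0 _]; split => /=.
  - by split=> /=; nra.
  - have bx := mulr_ge0 b0 x0; have tbx := mulr_ge0 (ltW t0) bx.
    have -> : k + b * (x + t * x) = k + b * x + t * (b * x) by ring.
    by rewrite -addrA ltr_wpDr // addr_ge0.
  have A0 : 0 <= b * x * (a * x + b * y).
    by rewrite mulr_ge0 ?addr_ge0 ?mulr_ge0 // ltW.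
  have -> : numer (x + t * x) - (y + t * y) * denom (x + t * x) =
     t * (b * x * (a * x + b * y) * (1 + t) + l * k)
     + (1 + t) * (numer x - y * denom x) by rewrite /numer /denom; ring.
  rewrite E subrr mulr0 addr0 mulr_gt0 // ltr_wpDl ?mulr_gt0 // mulr_ge0 //; lra.
have d0 : 0 < denom x.
  by rewrite subr_gt0 (le_lt_trans _ a_pos) // mulr_le0_ge0 // ltW.
have [y1|y1] := ltP 0 y.
  have k1 : 0 < k + b * x.
    rewrite lt0r k0 andbT; apply/eqP => k1; move: E; rewrite /numer k1 mul0r => /esym /eqP.
    by rewrite mulf_eq0 !gt_eqF.
  (* Lowering the second gain raises the Routh function, because the denominator is positive. *)
  apply: (@closure_path _ _ (0, - y)) => /= t /andP[t0 t1]; split => /=.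
  - by split=> /=; nra.
  - by nra.
  rewrite mulr0 addr0 E.
  have -> : y * denom x - (y + t * - y) * denom x = t * (y * denom x) by ring.
  by rewrite !mulr_gt0.
have {y0 y1}y0 : y = 0 by apply/eqP; rewrite eq_le y1 y0.
(* At a foot of the arch the segment runs along the axis to the other foot. [w_pos] puts the zero
   [l / a] of [c1] to the left of the zero [- k / b] of the trace, so both factors are positive in
   between. *)
subst y; move/eqP: E; rewrite mul0r mulf_eq0 => /orP[] /eqP E.
  have v0 : 0 < a * x - l.
    have : b * (a * x - l) < 0.
      have -> : b * (a * x - l) = a * (k + b * x) - (a * k + b * l) by ring.
      by rewrite E mulr0 sub0r oppr_lt0.
    by rewrite nmulr_rlt0.
  apply: (@closure_path _ _ (- (a * x - l) / a, 0)) => /= t /andP[t0 t1].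
  set x' := x + _.
  have Ea : a * x' - l = (1 - t) * (a * x - l) by rewrite /x'; field; rewrite gt_eqF.
  have Ek : k + b * x' = (k + b * x) + t * (- b * (a * x - l) / a).
    by rewrite /x'; field; rewrite gt_eqF.
  rewrite E add0r in Ek.
  have ax : 0 < a * x' - l by rewrite Ea; nra.
  have kx : 0 < k + b * x' by rewrite Ek mulr_gt0 // divr_gt0 // mulr_gt0 // oppr_gt0.
  split=> //=; last by rewrite mulr0 addr0 mul0r subr0 mulr_gt0.
  by split=> /=; nra.
have k1 : 0 < k + b * x by nra.
apply: (@closure_path _ _ (- (k + b * x) / b, 0)) => /= t /andP[t0 t1].
have v0 : 0 < - (k + b * x) / b by rewrite ltr_ndivlMr // mul0r oppr_lt0.
set x' := x + _.
have Ek : k + b * x' = (1 - t) * (k + b * x) by rewrite /x'; field; rewrite lt_eqF.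
have Ea : a * x' - l = (a * x - l) + t * (a * (- (k + b * x) / b)).
  by rewrite /x'; field; rewrite lt_eqF.
rewrite E add0r in Ea.
have kx : 0 < k + b * x' by rewrite Ek; nra.
have ax : 0 < a * x' - l by rewrite Ea mulr_gt0 // mulr_gt0.
split=> //=; last by rewrite mulr0 addr0 mul0r subr0 mulr_gt0.
by split=> /=; nra.
Qed.

Lemma gain_boundaryE :
  closure gain_region `&` closure (@quadrant R `\` gain_region) = gain_boundary.
Proof.
apply/seteqP; split; first exact: gain_boundary_sub.
move=> e Be; split; first exact: gain_boundary_closure.
apply: subset_closure; case: Be => Qe _ E; split=> // -[_ _].
by rewrite E subrr ltxx.
Qed.

End GainPlane.

(** * Shape of the stability boundary *)

Section Shape.
Variables (R : realType) (a b k l : R).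
Hypotheses (a_pos : 0 < a) (k_pos : 0 < k) (l_pos : 0 < l).
Hypothesis w_pos : 0 < a * k + b * l.

Let N := numer a b k l.
Let t := denom a b k.
Let g x := N x / t x.
(** [xl] is the zero of [c1] on the axis and [xa], for [b != 0], the zero of the denominator. The
    constant [q] is [a * t xl]; comparing it with [t x * t y] decides the sign of the increments of
    [g]. *)
Let q := a ^+ 2 - b * (a * k + b * l).
Let xl := l / a.
Let xa := (a - b * k) / b ^+ 2.

Lemma denom_foot : a * t xl = q.
Proof. by rewrite /t /denom /xl /q; field; rewrite gt_eqF. Qed.

Lemma numer_foot : N xl = 0.
Proof. by rewrite /N /numer /xl [a * _]mulrC divfK ?gt_eqF // subrr mulr0. Qed.

Lemma denomB x y : t y - t x = - b ^+ 2 * (y - x).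
Proof. by rewrite /t /denom; ring. Qed.

Lemma denom_pole x : b != 0 -> t x = b ^+ 2 * (xa - x).
Proof. by move=> b0; rewrite /t /denom /xa; field. Qed.

(** For [b != 0] the gain [x] is affine in [t], so the quadratic [N] divided by [t] combines [t], 1
    and [1 / t]; the term with [q] comes from [1 / t]. This exact difference quotient takes the
    place of derivatives in all monotonicity and concavity arguments. *)
Lemma gain_graph_slope x y : b != 0 -> t x != 0 -> t y != 0 ->
  g y - g x = - (a / b) * (y - x) * (1 - q / (t x * t y)).
Proof.
move=> b0; rewrite /g /N /q /t /numer /denom => tx ty.
by field; apply/and3P.
Qed.

Lemma gain_boundary_graph x y : t x != 0 -> (N x = y * t x) <-> y = g x.
Proof.
by move=> t0; split=> [E|->]; rewrite /g ?E ?mulfK // divfK.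
Qed.

Lemma denom_lt x y : b != 0 -> (t x < t y) = (y < x).
Proof.
move=> b0; rewrite -subr_gt0 denomB mulNr -mulrN opprB pmulr_rgt0 ?subr_gt0 //.
by rewrite lt0r sqr_ge0 expf_neq0.
Qed.

Lemma denom_le x y : b != 0 -> (t x <= t y) = (y <= x).
Proof. by move=> b0; rewrite leNgt denom_lt // -leNgt. Qed.

(** * The arch for [b < 0] *)

Section Arch.
Hypothesis b_neg : b < 0.

Let xr := - k / b.
Let bN0 : b != 0. Proof. by rewrite lt_eqF. Qed.
Let slope_pos : 0 < - (a / b).
Proof. by rewrite oppr_gt0 pmulr_rlt0 // invr_lt0. Qed.

(** This is [w_pos] once more: the trace at [xl] is [(a k + b l) / a]. *)
Lemma foot_lt : xl < xr.
Proof.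
have := (a_pos, b_neg, w_pos) => -[[a0 b0] w0].
rewrite /xl /xr ltr_ndivlMr // mulrAC ltr_pdivlMr //; lra.
Qed.

Let foot_gt0 : 0 < xl. Proof. exact: divr_gt0. Qed.

Lemma trace_ge0 x : (0 <= k + b * x) = (x <= xr).
Proof. by rewrite /xr ler_ndivlMr // -[RHS]subr_ge0 opprK [x * b]mulrC addrC. Qed.

Lemma trace_gt0 x : (0 < k + b * x) = (x < xr).
Proof. by rewrite /xr ltr_ndivlMr // -[RHS]subr_gt0 opprK [x * b]mulrC addrC. Qed.

Let ler_foot x : (0 <= a * x - l) = (xl <= x).
Proof. by rewrite subr_ge0 /xl ler_pdivrMr // mulrC. Qed.

Let ltr_foot x : (0 < a * x - l) = (xl < x).
Proof. by rewrite subr_gt0 /xl ltr_pdivrMr // mulrC. Qed.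

(** There is no pole over the part of the axis where the trace is nonnegative, so the whole boundary
    is a single graph. *)
Lemma denom_ge x : x <= xr -> a <= t x.
Proof.
rewrite -trace_ge0 => k0; rewrite /t /denom lerDl oppr_ge0.
by rewrite mulr_le0_ge0 // ltW.
Qed.

Let t_pos x : x <= xr -> 0 < t x.
Proof. by move/denom_ge; exact: lt_le_trans. Qed.

Lemma gain_boundary_arch :
  gain_boundary a b k l = graph_over [set x | xl <= x <= xr] g.
Proof.
apply/seteqP; split=> -[x y] /=.
  case=> -[/= x0 y0]; rewrite trace_ge0 => xxr E.
  have t0 := t_pos xxr; split=> /=; last by apply/gain_boundary_graph; rewrite // gt_eqF.
  rewrite xxr andbT; move: xxr; rewrite le_eqVlt => /orP[/eqP ->|]; first exact: ltW foot_lt.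
  rewrite -trace_gt0 => k0; rewrite -ler_foot -(pmulr_rge0 _ k0).
  by rewrite [_ * _]E mulr_ge0 // ltW.
case=> /andP[xlx xxr] /= ->; have t0 := t_pos xxr.
split => /=; [split=> /=| |].
- exact: le_trans (ltW foot_gt0) _.
- by rewrite divr_ge0 ?(ltW t0) // mulr_ge0 ?trace_ge0 ?ler_foot.
- by rewrite trace_ge0.
- by rewrite divfK // gt_eqF.
Qed.

Let q_pos : a ^+ 2 < q.
Proof. by rewrite ltrDl oppr_gt0 nmulr_rlt0. Qed.

Lemma gain_arch_concave : strictly_concave_on xl xr g.
Proof.
move=> x y s xlx xy yxr s0 s1; set m := s * x + _.
have mx : m - x = (1 - s) * (y - x) by rewrite /m; ring.
have ym : y - m = s * (y - x) by rewrite /m; ring.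
have xm : x < m by rewrite -subr_gt0 mx mulr_gt0 ?subr_gt0.
have my : m < y by rewrite -subr_gt0 ym mulr_gt0 ?subr_gt0.
have ty := t_pos yxr.
have tm : 0 < t m by apply: t_pos; exact: le_trans (ltW my) yxr.
have tx : 0 < t x by apply: t_pos; exact: le_trans (ltW xy) yxr.
have E1 := gain_graph_slope bN0 (lt0r_neq0 tx) (lt0r_neq0 tm).
have E2 := gain_graph_slope bN0 (lt0r_neq0 tm) (lt0r_neq0 ty).
rewrite -subr_gt0.
(* In this weighted difference of increments the linear parts cancel. What remains is governed by
   [1 / t], which is increasing in the gain because [t] decreases. *)
have -> : g m - (s * g x + (1 - s) * g y) = s * (g m - g x) - (1 - s) * (g y - g m) by ring.
rewrite E1 E2 mx ym.
have -> : s * (- (a / b) * ((1 - s) * (y - x)) * (1 - q / (t x * t m)))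
    - (1 - s) * (- (a / b) * (s * (y - x)) * (1 - q / (t m * t y)))
  = - (a / b) * (s * (1 - s) * (y - x)) * (q / t m) * ((t y)^-1 - (t x)^-1).
  by rewrite !invfM; ring.
rewrite mulr_gt0 ?subr_gt0 ?ltf_pV2 ?denom_lt //.
rewrite mulr_gt0 ?divr_gt0 ?(lt_trans _ q_pos) ?exprn_gt0 //.
by rewrite !mulr_gt0 ?subr_gt0.
Qed.

(* The arch is proportional to (a + t0) - t - a t0 / t in the variable
   t = denom x, which runs from t0 down to a; hence the vertex lies at the
   geometric mean of a and t0. *)
Lemma gain_arch : parabolic_arch xl xr g.
Proof.
have kr : k + b * xr = 0 by rewrite /xr mulrC divfK // subrr.
have tr : t xr = a by rewrite /t /denom kr mulr0 subr0.
split.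
- by rewrite /g numer_foot mul0r.
- by rewrite /g /N /numer kr !mul0r.
- move=> x /andP[xlx xxr]; rewrite divr_gt0 ?t_pos 1?ltW //.
  by rewrite mulr_gt0 ?trace_gt0 ?ltr_foot.
- exact: gain_arch_concave.
have a0 := a_pos; have q0 := q_pos.
have a20 : 0 < a ^+ 2 by rewrite exprn_gt0.
have q_gt0 : 0 < q by lra.
pose tm := Num.sqrt q.
have tm2 : tm ^+ 2 = q by rewrite sqr_sqrtr // ltW.
have tm0 : 0 < tm by rewrite sqrtr_gt0.
have atm : a < tm by rewrite -(ltr_pXn2r (n := 2)) ?nnegrE ?ltW // tm2.
pose xm := xa - tm / b ^+ 2.
have txm : t xm = tm by rewrite denom_pole // /xm; field.
have lm : xl < xm.
  by rewrite -denom_lt // txm -(ltr_pM2l a_pos) denom_foot -tm2 expr2 ltr_pM2r.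
have mr : xm < xr by rewrite -denom_lt // tr txm.
exists xm; first by rewrite lm mr.
have slope x y : x < y -> y <= xr ->
    ((q < t x * t y) -> g x < g y) /\ ((t x * t y < q) -> g y < g x).
  move=> xy yr; have ty := t_pos yr.
  have tx : 0 < t x by apply: t_pos; exact: le_trans (ltW xy) yr.
  have txy : 0 < t x * t y by rewrite mulr_gt0.
  have E := gain_graph_slope bN0 (lt0r_neq0 tx) (lt0r_neq0 ty).
  have c0 : 0 < - (a / b) * (y - x) by rewrite mulr_gt0 // subr_gt0.
  split=> qt; first by rewrite -subr_gt0 E pmulr_rgt0 // subr_gt0 ltr_pdivrMr // mul1r.
  by rewrite -subr_lt0 E pmulr_rlt0 // subr_lt0 ltr_pdivlMr // mul1r.
split=> x y.
  move=> _ xy ym; apply: (slope x y xy _).1; first exact: le_trans ym (ltW mr).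
  have tx : tm < t x by rewrite -txm denom_lt // (lt_le_trans xy).
  rewrite -tm2 expr2; apply: (@lt_le_trans _ _ (t x * tm)); first by rewrite ltr_pM2r.
  by rewrite ler_pM2l ?(lt_trans tm0) // -txm denom_le.
move=> mx xy yr; apply: (slope x y xy _).2 => //.
have ty := t_pos yr.
rewrite -tm2 expr2; apply: (@le_lt_trans _ _ (tm * t y)).
  by rewrite ler_pM2r // -txm denom_le.
by rewrite ltr_pM2l // -txm denom_lt // (le_lt_trans mx).
Qed.

End Arch.

(** * The monotone or vertical boundary for [b >= 0] *)

Section Monotone.
Hypothesis b_ge0 : 0 <= b.

Let B := gain_boundary a b k l.
Let foot_gt0 : 0 < xl. Proof. exact: divr_gt0. Qed.

Let trace_pos x : 0 <= x -> 0 < k + b * x.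
Proof. by move=> x0; rewrite ltr_wpDr // mulr_ge0. Qed.

Let numer_ge0 x : 0 <= x -> (0 <= N x) = (xl <= x).
Proof.
move=> x0; rewrite /N /numer pmulr_rge0 ?trace_pos //.
by rewrite subr_ge0 /xl ler_pdivrMr // mulrC.
Qed.

Let numer_gt0 x : 0 <= x -> (0 < N x) = (xl < x).
Proof.
move=> x0; rewrite /N /numer pmulr_rgt0 ?trace_pos //.
by rewrite subr_gt0 /xl ltr_pdivrMr // mulrC.
Qed.

Let numer_lt0 x : 0 <= x -> (N x < 0) = (x < xl).
Proof. by move=> x0; rewrite ltNge numer_ge0 // -ltNge. Qed.

Let numer_le0 x : 0 <= x -> (N x <= 0) = (x <= xl).
Proof. by move=> x0; rewrite leNgt numer_gt0 // -leNgt. Qed.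

Lemma gain_boundary_meets_r : meets_r_axis B.
Proof.
exists xl; split=> /=; first by split; rewrite //= ltW.
- by rewrite ltW // trace_pos // ltW.
- by rewrite mul0r; exact: numer_foot.
Qed.

Let B_graph x y : 0 <= x -> 0 <= y -> t x != 0 -> y = g x -> B (x, y).
Proof.
move=> x0 y0 t0 E; split=> //=; first by rewrite ltW // trace_pos.
exact/gain_boundary_graph.
Qed.

Lemma gain_boundary_line : b = 0 -> monotone_graph B [set x | xl <= x] g.
Proof.
move=> b0; have tE x : t x = a by rewrite /t /denom b0 mul0r subr0.
have gB x y : g y - g x = k * (y - x).
  by rewrite /g /N /numer !tE b0; field; rewrite gt_eqF.
split.
- by move=> x y /= xx _ z /andP[xz _]; exact: le_trans xz.
- by exists xl, (xl + 1); rewrite /= lexx lerDl ltrDl ler01 ltr01.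
- by left=> x y _ _ xy; rewrite -subr_gt0 gB mulr_gt0 ?subr_gt0.
apply/seteqP; split=> -[x y] /=.
  case=> -[/= x0 y0] _ E; have t0 : t x != 0 by rewrite tE gt_eqF.
  split => /=; last exact/gain_boundary_graph.
  by rewrite -numer_ge0 // [N _]E mulr_ge0 // -/(t x) tE ltW.
case=> /= xlx E; have x0 : 0 <= x by apply: le_trans xlx; rewrite ltW.
apply: B_graph => //; last by rewrite tE gt_eqF.
by rewrite E divr_ge0 ?numer_ge0 // tE ltW.
Qed.

Section PositiveSlope.
Hypothesis b_gt0 : 0 < b.
Let bN0 : b != 0. Proof. by rewrite gt_eqF. Qed.
Let b2 : 0 < b ^+ 2. Proof. by rewrite exprn_gt0. Qed.

Let denom_gt0 x : (0 < t x) = (x < xa).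
Proof. by rewrite denom_pole // pmulr_rgt0 // subr_gt0. Qed.

Let denom_lt0 x : (t x < 0) = (xa < x).
Proof. by rewrite denom_pole // pmulr_rlt0 // subr_lt0. Qed.

Let foot_ltN : t xl < a.
Proof. by rewrite /t /denom ltrBlDr ltrDl mulr_gt0 // trace_pos // ltW. Qed.

Let ratio_pos : 0 < a / b. Proof. exact: divr_gt0. Qed.

(** Numerator and denominator share their zero, so the Routh function splits off the factor
    [x - xl]; the cofactor is positive in the quadrant. *)
Lemma gain_boundary_vertical : xl = xa -> vertical_line B.
Proof.
move=> E; exists xl.
have key x y : N x - y * t x = (x - xl) * (a * (k + b * x) + y * b ^+ 2).
  rewrite denom_pole // -E /N /numer; have -> : a * x - l = a * (x - xl).
    by rewrite /xl; field; rewrite gt_eqF.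
  by ring.
apply/seteqP; split=> -[x y] /=.
  case=> -[/= x0 y0] _ /eqP; rewrite -subr_eq0 key mulf_eq0 subr_eq0 => /orP[/eqP//|].
  by rewrite gt_eqF // ltr_wpDr ?(mulr_ge0 y0) ?(ltW b2) // mulr_gt0 // trace_pos.
case=> -> y0; split=> /=; first by split; rewrite //= ltW.
- by rewrite ltW // trace_pos // ltW.
- by apply/eqP; rewrite -subr_eq0 key subrr mul0r.
Qed.

Lemma gain_boundary_increasing : xl < xa ->
  monotone_graph B [set x | xl <= x < xa] g.
Proof.
move=> la; have tl0 : 0 < t xl by rewrite denom_gt0.
have qE := denom_foot.
split.
- move=> x y /= /andP[xx _] /andP[_ yy] z /andP[xz zy].
  by rewrite (le_trans xx xz) (le_lt_trans zy yy).
- have [xm1 xm2] := midf_lt la.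
  by exists xl, ((xl + xa) / 2); rewrite /= lexx la xm2 ltW.
- left=> x y /= /andP[xlx xxa] /andP[xly yxa] xy.
  have tx : 0 < t x by rewrite denom_gt0.
  have ty : 0 < t y by rewrite denom_gt0.
  have txy : 0 < t x * t y by rewrite mulr_gt0.
  rewrite -subr_gt0 gain_graph_slope ?gt_eqF //.
  rewrite mulNr mulNr -mulrN mulr_gt0 //; first by rewrite mulr_gt0 // subr_gt0.
  rewrite opprB subr_gt0 ltr_pdivlMr // mul1r -qE.
  (* As [t] decreases from [t xl < a], one has [t y <= t xl] and [t x < a], hence
     [t x * t y < a * t xl = q]. *)
  apply: (@le_lt_trans _ _ (t x * t xl)).
    by rewrite ler_pM2l // denom_le.
  by rewrite ltr_pM2r // (le_lt_trans _ foot_ltN) // denom_le.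
apply/seteqP; split=> -[x y] /=.
  case=> -[/= x0 y0] _ E.
  have xxa : x < xa.
    rewrite ltNge; apply/negP => xax.
    have : 0 < N x by rewrite numer_gt0 // (lt_le_trans la).
    by rewrite [N x]E ltNge mulr_ge0_le0 // leNgt denom_gt0 -leNgt.
  have tx : 0 < t x by rewrite denom_gt0.
  split=> /=; last by apply/gain_boundary_graph; rewrite // gt_eqF.
  by rewrite xxa andbT -numer_ge0 // [N x]E mulr_ge0 // ltW.
case=> /= /andP[xlx xxa] E; have x0 : 0 <= x by apply: le_trans xlx; rewrite ltW.
have tx : 0 < t x by rewrite denom_gt0.
by apply: B_graph => //; rewrite ?E ?gt_eqF // divr_ge0 ?numer_ge0 // ltW.
Qed.

(** Beyond the zero of the denominator [t] is negative, so [q = a * t xl < 0 < t x * t y] and the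
    slope keeps the sign of [- a / b]. *)
Lemma gain_boundary_decreasing : xa < xl ->
  monotone_graph B [set x | 0 <= x /\ xa < x <= xl] g.
Proof.
move=> al; have tl0 : t xl < 0 by rewrite denom_lt0.
have qE := denom_foot.
have q0 : q < 0 by rewrite -qE pmulr_rlt0.
split.
- move=> x y /= [x0 /andP[xx _]] [_ /andP[_ yy]] z /andP[xz zy].
  by rewrite (le_trans x0 xz) (lt_le_trans xx xz) (le_trans zy yy).
- have : Num.max 0 xa < xl by rewrite gt_max foot_gt0.
  move=> ml; have [m1 m2] := midf_lt ml.
  exists ((Num.max 0 xa + xl) / 2), xl; split=> //=.
    split; first by rewrite (le_trans _ (ltW m1)) // le_max lexx.
    by rewrite (ltW m2) andbT (le_lt_trans _ m1) // le_max lexx orbT.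
  by rewrite ltW // al lexx.
- right=> x y /= [x0 /andP[xax xxl]] [y0 /andP[xay yxl]] xy.
  have tx : t x < 0 by rewrite denom_lt0.
  have ty : t y < 0 by rewrite denom_lt0.
  have txy : 0 < t x * t y by rewrite nmulr_rgt0.
  rewrite -subr_lt0 (gain_graph_slope bN0) ?lt_eqF //.
  rewrite mulNr mulNr oppr_lt0 mulr_gt0 //; first by rewrite mulr_gt0 // subr_gt0.
  by rewrite subr_gt0 ltr_pdivrMr // mul1r (lt_trans q0).
apply/seteqP; split=> -[x y] /=.
  case=> -[/= x0 y0] _ E.
  have xxa : xa < x.
    rewrite ltNge; apply/negP => xax.
    have : N x < 0 by rewrite numer_lt0 // (le_lt_trans xax).
    by rewrite [N x]E ltNge mulr_ge0 // leNgt denom_lt0 -leNgt.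
  have tx : t x < 0 by rewrite denom_lt0.
  split=> /=; last by apply/gain_boundary_graph; rewrite // lt_eqF.
  by split=> //; rewrite xxa -numer_le0 // [N x]E mulr_ge0_le0 // ltW.
case=> /= -[x0 /andP[xax xxl]] E.
have tx : t x < 0 by rewrite denom_lt0.
apply: B_graph => //; rewrite ?lt_eqF // E /g mulr_le0 //; first by rewrite numer_le0.
by rewrite invr_le0 ltW.
Qed.

(** The sign [s] treats both sides of the pole at once: multiplied by [s * t x > 0], the inequality
    [M < g x] becomes a polynomial one that holds at [xa] itself and hence nearby. *)
Let pole_limit (D : set R) (s : R) : 0 < s * N xa ->
  (forall x, D x -> 0 < s * t x) -> g x @[x --> within D (nbhs xa)] --> +oo.
Proof.
move=> sN st; apply/cvgryPgt => M.
have cF : (fun x => s * (N x - M * t x)) x @[x --> xa] --> s * (N xa - M * t xa).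
  apply: cvgM; first exact: cvg_cst.
  apply: cvgB; first exact: continuous_numer.
  by apply: cvgM; [exact: cvg_cst|exact: continuous_denom].
have F0 : 0 < s * (N xa - M * t xa).
  by rewrite [t xa]denom_pole // subrr !mulr0 subr0.
rewrite near_withinE; near=> x => Dx.
have : 0 < s * (N x - M * t x) by near: x; exact: (cvgr_gt _ cF).
have tx := st x Dx; have t0 : t x != 0 by apply: contraTneq tx => ->; rewrite mulr0 ltxx.
have -> : s * (N x - M * t x) = s * t x * (g x - M).
  by rewrite /g; field.
by rewrite pmulr_rgt0 // subr_gt0.
Unshelve. all: by end_near.
Qed.

Lemma gain_asymptote_increasing : xl < xa ->
  vertical_asymptote [set x | xl <= x < xa] g xa.
Proof.
move=> la; split.
- by rewrite /= ltxx andbF.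
- move=> V Va; have : \forall x \near xa^'-, (xl <= x < xa) /\ V x.
    near=> x; split; last first.
      by near: x; exact: (cvg_at_left_filter cvg_id).
    apply/andP; split; first by near: x; apply: nbhs_left_ge.
    by near: x; exact: nbhs_left_lt.
  by move/(@filter_ex _ xa^'- _) => [x [? ?]]; exists x.
- apply: (@pole_limit _ 1) => [|x /andP[_ ?]]; rewrite mul1r.
    by rewrite numer_gt0 // ltW // (lt_trans foot_gt0).
  by rewrite denom_gt0.
Unshelve. all: by end_near.
Qed.

Lemma gain_asymptote_decreasing : 0 <= xa -> xa < xl ->
  vertical_asymptote [set x | 0 <= x /\ xa < x <= xl] g xa.
Proof.
move=> a0 al; split.
- by rewrite /= ltxx => -[].
- move=> V Va; have : \forall x \near xa^'+, (0 <= x /\ xa < x <= xl) /\ V x.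
    near=> x; split; last first.
      by near: x; exact: (cvg_at_right_filter cvg_id).
    have xax : xa < x by near: x; exact: nbhs_right_gt.
    split; first exact: le_trans a0 (ltW xax).
    by rewrite xax; near: x; apply: nbhs_right_le.
  by move/(@filter_ex _ xa^'+ _) => [x [? ?]]; exists x.
- apply: (@pole_limit _ (- 1)) => [|x [_ /andP[? _]]]; rewrite mulN1r oppr_gt0.
    by rewrite numer_lt0.
  by rewrite denom_lt0.
Unshelve. all: by end_near.
Qed.

End PositiveSlope.

(** For [b > 0] the order of [xl] and [xa] decides. An increasing graph starts at [xl > 0] and
    cannot meet the vertical axis; a decreasing one meets it exactly when [xa < 0]; if [xl = xa] the
    boundary is a line. *)
Lemma gain_boundary_monotone : vertical_line B \/
  exists D f, monotone_graph B D f /\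
    (0 < b -> meets_psi_axis B \/
      ~ meets_psi_axis B /\ vertical_asymptote D f xa).
Proof.
move: b_ge0; rewrite le_eqVlt => /orP[/eqP/esym b0|b0].
  right; exists [set x | xl <= x], g; split; first exact: gain_boundary_line.
  by rewrite b0 ltxx.
case: (ltgtP xl xa) => la.
- right; exists [set x | xl <= x < xa], g.
  have MG := gain_boundary_increasing b0 la.
  split=> // _; right; split; last exact: gain_asymptote_increasing.
  case: MG => _ _ _ ->; case=> y [] /= /andP[+ _] _.
  by rewrite leNgt foot_gt0.
- right; exists [set x | 0 <= x /\ xa < x <= xl], g.
  have MG := gain_boundary_decreasing b0 la.
  split=> // _; case: MG => _ _ _ ->.
  have [a0|a0] := leP 0 xa; [right|left].
    split; last exact: gain_asymptote_decreasing.
    by case=> y [] /= [_ /andP[+ _]] _; rewrite ltNge a0.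
  by exists (g 0); split=> //=; rewrite lexx a0 ltW.
- by left; exact: gain_boundary_vertical.
Qed.

End Monotone.
End Shape.

(** * Eigenvalue branches *)

Section Branches.
Variable R : realType.
Implicit Types (s x : R).

(** In Caratheodory's form of differentiability one may divide by a factor that is only continuous.
    This is needed because [D] will contain the unknown eigenvalue [P] itself. *)
Lemma is_derive_quotient (P D H : R -> R) s0 d :
  P s0 = 0 -> (\forall s \near s0, P s * D s = H s) ->
  {for s0, continuous D} -> D s0 != 0 -> is_derive s0 1 H d ->
  is_derive s0 1 P (d / D s0).
Proof.
move=> P0 PD cD D0 /is_derive1_caratheodory [G [HE cG <-]].
have H0 : H s0 = 0 by rewrite -(nbhs_singleton PD) P0 mul0r.
pose F s := G s / D s * (s - s0).
apply: (@near_eq_is_derive _ _ _ F).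
  near=> s; have Ds : D s != 0 by near: s; exact: (cvgr_neq0 _ cD D0).
  have Es : P s * D s = H s by near: s; exact: PD.
  by rewrite /F mulrAC -HE H0 subr0 -Es mulfK.
apply/is_derive1_caratheodory; exists (fun s => G s / D s); split=> //.
  by move=> s; rewrite /F subrr mulr0 subr0.
by apply: cvgM => //; exact: cvgV.
Unshelve. all: by end_near.
Qed.

Lemma quadratic_coefficient (y : R -> R) s0 :
  y s0 = 0 -> derive1 y s0 = 0 -> (\forall s \near s0, derivable y s 1) ->
  derivable (derive1 y) s0 1 ->
  exists k : R -> R, {for s0, continuous k} /\
    \forall s \near s0, y s = k s * (s - s0) ^+ 2.
Proof.
move=> y0 y'0 dy /derivableP dy'.
have /is_derive1_caratheodory [G [GE cG _]] := dy'.
pose K := G s0.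
pose k s := if s == s0 then K / 2 else y s / (s - s0) ^+ 2.
exists k; split; last first.
  near=> s; rewrite /k; case: eqP => [->|/eqP s0s]; first by rewrite y0 subrr expr0n mulr0.
  by rewrite divfK // expf_neq0 // subr_eq0.
(* [K] is the second derivative at [s0] and [f] the Taylor remainder. By the mean value theorem
   [f s = (G c - K) (c - s0) (s - s0)] with [c] between [s0] and [s], so continuity of [G] at [s0]
   gives that of [k]. *)
pose f s := y s - K / 2 * (s - s0) ^+ 2.
have f0 : f s0 = 0 by rewrite /f y0 subrr expr0n mulr0 subr0.
apply/cvgrPdist_le => /= eps eps0.
have : \forall s \near s0, derivable y s 1 /\ `|G s - K| <= eps.
  near=> s; split; first by near: s.
  by near: s; move/cvgr_distC_le : cG; exact.
move/nbhs_ballP => [r /= r0 Hr].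
have s0r := nbhsx_ballx s0 r r0.
near=> s.
have sr : ball s0 r s by near: s.
have [->|s0s] := eqVneq s s0; first by rewrite subrr normr0 ltW.
rewrite /k eqxx (negPf s0s).
have D x : derivable y x 1 -> is_derive x 1 f (derive1 y x - K * (x - s0)).
  move=> /derivableP Dx; rewrite -derive1E in Dx.
  apply: is_derive_eq; rewrite /GRing.scale /=; by field.
have [c cs Ec] : exists2 c, `|c - s0| <= `|s - s0| &
    f s = (derive1 y c - K * (c - s0)) * (s - s0).
  have dist_ball x : `|x - s0| <= `|s - s0| -> ball s0 r x.
    by move=> xs; rewrite /ball /= distrC (le_lt_trans xs) // distrC.
  have Dball x : `|x - s0| <= `|s - s0| -> is_derive x 1 f (derive1 y x - K * (x - s0)).
    by move=> /dist_ball /Hr [? _]; exact: D.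
  have [ss|ss|E] := ltgtP s s0; last by rewrite E eqxx in s0s.
    have I x : x \in `[s, s0] -> `|x - s0| <= `|s - s0|.
      by rewrite in_itv /= => /andP[sx xs]; rewrite !ler0_norm ?subr_le0 ?(ltW ss) //; lra.
    have [||c cI E] := @MVT_segment R f (fun x => derive1 y x - K * (x - s0)) s s0 (ltW ss).
    - by move=> x /subset_itv_oo_cc /I; exact: Dball.
    - by apply: derivable_within_continuous => x /I /Dball [].
    exists c; first exact: I.
    by rewrite -[f s]opprK -[- f s]add0r -{1}f0 E; ring.
  have I x : x \in `[s0, s] -> `|x - s0| <= `|s - s0|.
    by rewrite in_itv /= => /andP[sx xs]; rewrite !ger0_norm ?subr_ge0 ?(ltW ss) //; lra.
  have [||c cI E] := @MVT_segment R f (fun x => derive1 y x - K * (x - s0)) s0 s (ltW ss).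
  - by move=> x /subset_itv_oo_cc /I; exact: Dball.
  - by apply: derivable_within_continuous => x /I /Dball [].
  by exists c; [exact: I|rewrite -E f0 subr0].
have cb : ball s0 r c by rewrite /ball /= distrC (le_lt_trans cs) // distrC.
have [_ Gc] := Hr c cb.
have s2 : 0 < `|s - s0| ^+ 2 by rewrite exprn_gt0 // normr_gt0 subr_eq0.
have -> : K / 2 - y s / (s - s0) ^+ 2 = - f s / (s - s0) ^+ 2.
  by rewrite /f; field; rewrite subr_eq0.
rewrite normrM normrN normfV normrX ler_pdivrMr // Ec.
have -> : derive1 y c - K * (c - s0) = (G c - K) * (c - s0).
  by rewrite mulrBl -GE y'0 subr0.
by rewrite !normrM -mulrA ler_pM // expr2 ler_pM.
Unshelve. all: by end_near.
Qed.

Section PairSum.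
Variables (d2 d1 H : R -> R) (s0 : R).
Hypotheses (cd2 : {for s0, continuous d2}) (cd1 : {for s0, continuous d1}).
Hypotheses (cH : {for s0, continuous H}) (H0 : H s0 = 0).
Hypothesis pos : 0 < d1 s0 + d2 s0 ^+ 2.

Let Phi s x := x * (d1 s + (d2 s - x) ^+ 2) - H s.

(* The sum -P of a pair of roots of X^3 + d2 X^2 + d1 X + d0 near the imaginary
   axis solves P (d1 + (d2 - P)^2) = H, with H = d1 d2 - d0. *)
Lemma pair_sum : exists P : R -> R, [/\ P s0 = 0,
  \forall s \near s0, P s * (d1 s + (d2 s - P s) ^+ 2) = H s &
  \forall s \near s0, {for s, continuous d2} -> {for s, continuous d1} ->
    {for s, continuous H} -> {for s, continuous P}].
Proof.
have pos' := pos.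
(* Near [s0] the slope of [Phi s] is at least [3 / 2 * m] minus the cross term, and [r] is small
   enough to keep that term below [m / 2]. The bound [m * r] on [H s] then forces a sign change of
   [Phi s] on [[-r, r]]. *)
pose m := (d1 s0 + d2 s0 ^+ 2) / 2.
pose K : R := `|d2 s0| + 1.
pose r := m / (8 * K).
have m0 : 0 < m by rewrite divr_gt0.
have K0 : 0 < K by rewrite ltr_wpDl.
have r0 : 0 < r by rewrite divr_gt0 // mulr_gt0.
have near_good : \forall s \near s0,
    [/\ `|d2 s| <= K, 3 / 2 * m <= d1 s + d2 s ^+ 2 & `|H s| <= m * r].
  near=> s; split.
  - have : `|d2 s0 - d2 s| < 1 by near: s; have /cvgrPdist_lt := cd2; apply.
    have := ler_normD (d2 s0) (d2 s - d2 s0); rewrite subrKC distrC /K => ? ?; lra.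
  - apply: ltW; near: s; apply: (@cvgr_gt _ _ _ _ _ (d1 s0 + d2 s0 ^+ 2)).
      apply: cvgD => //; apply: (@continuous_comp _ _ _ d2 (fun x => x ^+ 2)) => //.
      exact: exprn_continuous.
    by rewrite /m; lra.
  - apply: ltW; near: s; apply: (@cvgr_lt _ _ _ _ _ `|H s0|); first exact: cvg_norm.
    by rewrite H0 normr0 mulr_gt0.
pose good s :=
  (forall (x x' : R), `|x| <= r -> `|x'| <= r ->
     m * `|x - x'| <= `|Phi s x - Phi s x'|)
   /\ exists x : R, `|x| <= r /\ Phi s x = 0.
have {}near_good : \forall s \near s0, good s.
  near=> s.
  have [dK dm Hm] : [/\ `|d2 s| <= K, 3 / 2 * m <= d1 s + d2 s ^+ 2 & `|H s| <= m * r].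
    by near: s.
  have slope x (x' : R) : `|x| <= r -> `|x'| <= r ->
    m <= d1 s + d2 s ^+ 2 - 2 * d2 s * (x + x') + (x ^+ 2 + x * x' + x' ^+ 2).
    move=> xr x'r; have sq : 0 <= x ^+ 2 + x * x' + x' ^+ 2 by nra.
    have : `|2 * d2 s * (x + x')| <= m / 2.
      have -> : m / 2 = 2 * K * (r + r) by rewrite /r; field; rewrite gt_eqF.
      rewrite !normrM ger0_norm // ler_pM ?mulr_ge0 //; first by rewrite ler_pM2l.
      by rewrite (le_trans (ler_normD _ _)) // lerD.
    by move=> /(le_trans (ler_norm _)) => ?; lra.
  have PhiB x (x' : R) : Phi s x - Phi s x' =
    (x - x') * (d1 s + d2 s ^+ 2 - 2 * d2 s * (x + x') + (x ^+ 2 + x * x' + x' ^+ 2)).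
    by rewrite /Phi; ring.
  split=> [x x' xr x'r|].
    have mS := slope x x' xr x'r.
    by rewrite PhiB normrM mulrC ler_pM // ?(ltW m0) // (le_trans mS) // ler_norm.
  pose F : {poly R} := 'X * ((d1 s)%:P + ((d2 s)%:P - 'X) ^+ 2) - (H s)%:P.
  have FE x : F.[x] = Phi s x by rewrite /F !hornerE.
  have Hr := ler_norm (H s); have Hl : - `|H s| <= H s by exact: lerNnormlW.
  have nr : `|r| <= r by rewrite gtr0_norm.
  have n0 : `|0 : R| <= r by rewrite normr0 ltW.
  have nNr : `|- r| <= r by rewrite normrN gtr0_norm.
  have Phi0 : Phi s 0 = - H s by rewrite /Phi mul0r sub0r.
  have [] := @poly_ivt R F (- r) r; first by lra.
    rewrite !FE; apply/andP; split.
      have := slope _ _ nNr n0; have := PhiB (- r) 0; rewrite Phi0.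
      set S := (d1 s + _ - _ + _) => E mS.
      have : r * m <= r * S by rewrite ler_pM2l.
      by move: E => ? ?; nra.
    have := slope _ _ nr n0; have := PhiB r 0; rewrite Phi0.
    set S := (d1 s + _ - _ + _) => E mS.
    have : r * m <= r * S by rewrite ler_pM2l.
    by move: E => ? ?; nra.
  by move=> x xr /rootP; rewrite FE => Fx; exists x; rewrite ler_norml.
pose P s := xget 0 [set x | `|x| <= r /\ Phi s x = 0].
have PP s : good s -> `|P s| <= r /\ Phi s (P s) = 0.
  by move=> [_ [x Hx]]; rewrite /P; case: xgetP => [y _ //|/(_ x)].
exists P; split.
- have [P1 P2] := PP _ (nbhs_singleton near_good).
  have [slope _] := nbhs_singleton near_good.
  have := slope (P s0) 0 P1; rewrite normr0 => /(_ (ltW r0)).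
  rewrite P2 /Phi H0 mul0r !subr0 normr0 pmulr_rle0 // normr_le0.
  by move/eqP.
- near=> s; have /PP [_ /eqP] : good s by near: s.
  by rewrite subr_eq0 => /eqP.
have near_good2 : \forall s \near s0, \forall s' \near s, good s' by exact: near_join.
near=> s => c2 c1 cHs.
have good_s : good s by near: s.
have good_near : \forall s' \near s, good s' by near: s.
have [P1 P2] := PP _ good_s.
(* Since [P s'] is a zero of [Phi s'], the slope bound gives [m * |P s - P s'| <= |Phi s' (P s)|],
   and the right-hand side tends to 0. *)
have cPhi : Phi s' (P s) @[s' --> s] --> Phi s (P s).
  apply: cvgB => //; apply: cvgM; first exact: cvg_cst.
  apply: cvgD => //.
  apply: (@continuous_comp _ _ _ (fun s => d2 s - P _) (fun x => x ^+ 2)).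
    by apply: cvgB => //; exact: cvg_cst.
  exact: exprn_continuous.
apply/cvgrPdist_le => eps eps0; near=> s'.
have [slope' ?] : good s' by near: s'.
have [P1' P2'] : `|P s'| <= r /\ Phi s' (P s') = 0 by exact: PP.
have := slope' _ _ P1 P1'; rewrite P2' subr0 => E.
rewrite -(ler_pM2l m0) (le_trans E) //.
near: s'; rewrite P2 in cPhi; move/cvgr0_norm_le : cPhi; apply.
by rewrite mulr_gt0.
Unshelve. all: by end_near.
Qed.

End PairSum.
End Branches.

(** * Roots of the cubic along a curve of gains *)

Section CubicPairs.
Variable R : realType.
Implicit Types (x y s : R).

Lemma cubic_root_pair (d2 d1 d0 : R) x y : y != 0 -> cubic_root d2 d1 d0 x y ->
  - 2 * x * (d1 + (d2 + 2 * x) ^+ 2) = d1 * d2 - d0.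
Proof.
move=> y0 [Ex /eqP]; rewrite mulf_eq0 (negPf y0) orbF => /eqP Ey.
have y2 : y ^+ 2 = 3 * x ^+ 2 + 2 * d2 * x + d1 by lra.
by move: Ex; rewrite y2 => ?; lra.
Qed.

(** The identity on [P] says that [X^2 + P X + Q] divides the cubic, with cofactor
    [X + (d2 - P)]. *)
Lemma pair_cubic_root (d2 d1 d0 : R) P Q x y : P * (d1 + (d2 - P) ^+ 2) = d1 * d2 - d0 ->
  Q = d1 - P * (d2 - P) -> quad_root P Q x y -> cubic_root d2 d1 d0 x y.
Proof.
move=> EP EQ [Ex Ey].
have E1 : d1 = Q + P * (d2 - P) by rewrite EQ; ring.
have E0 : d0 = Q * (d2 - P).
  have -> : d0 = d1 * d2 - P * (d1 + (d2 - P) ^+ 2) by rewrite EP; ring.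
  by rewrite EQ; ring.
rewrite E0 E1; split.
  transitivity ((x + (d2 - P)) * (x ^+ 2 - y ^+ 2 + P * x + Q)
    - y * ((2 * x + P) * y)); first ring.
  by rewrite Ex Ey; ring.
transitivity ((x + (d2 - P)) * ((2 * x + P) * y)
  + y * (x ^+ 2 - y ^+ 2 + P * x + Q)); first ring.
by rewrite Ex Ey; ring.
Qed.

(** With [d0 = 0] the cubic is [X] times the quadratic, so nonreal eigenvalues of [S] can be treated
    by the results for the cubic. *)
Lemma quad_cubic_root (sg d2 d1 : R) x y : y != 0 ->
  (x = sg /\ y = 0) \/ quad_root d2 d1 x y <-> cubic_root d2 d1 0 x y.
Proof.
move=> y0; split=> [[[_ E]|[Ex Ey]]|[Ex Ey]]; first by rewrite E eqxx in y0.
  split.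
    transitivity (x * (x ^+ 2 - y ^+ 2 + d2 * x + d1) - y * ((2 * x + d2) * y)); first ring.
    by rewrite Ex Ey; ring.
  transitivity (x * ((2 * x + d2) * y) + y * (x ^+ 2 - y ^+ 2 + d2 * x + d1)); first ring.
  by rewrite Ex Ey; ring.
right; have n0 : x ^+ 2 + y ^+ 2 != 0.
  by rewrite gt_eqF // ltr_wpDl ?sqr_ge0 // exprn_even_gt0.
split; apply: (mulfI n0); rewrite mulr0.
  transitivity (x * (x ^+ 3 - 3 * x * y ^+ 2 + d2 * (x ^+ 2 - y ^+ 2) + d1 * x + 0)
    + y * ((3 * x ^+ 2 - y ^+ 2 + 2 * d2 * x + d1) * y)); first ring.
  by rewrite Ex Ey; ring.
transitivity (x * ((3 * x ^+ 2 - y ^+ 2 + 2 * d2 * x + d1) * y)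
  - y * (x ^+ 3 - 3 * x * y ^+ 2 + d2 * (x ^+ 2 - y ^+ 2) + d1 * x + 0)); first ring.
by rewrite Ex Ey; ring.
Qed.

Section Family.
Variables (d2 d1 d0 : R -> R) (s0 : R).
Hypotheses (cd2 : {for s0, continuous d2}) (cd1 : {for s0, continuous d1}).
Hypothesis cd0 : {for s0, continuous d0}.

Let H s := d1 s * d2 s - d0 s.

Let continuous_H s : {for s, continuous d2} -> {for s, continuous d1} ->
  {for s, continuous d0} -> {for s, continuous H}.
Proof. by move=> ? ? ?; apply: cvgB => //; exact: cvgM. Qed.

Lemma pair_branch (w : R) : w != 0 -> d1 s0 = w ^+ 2 -> H s0 = 0 ->
  exists x y : R -> R, [/\ x s0 = 0, y s0 = w,
    \forall s \near s0, [/\ y s != 0, cubic_root (d2 s) (d1 s) (d0 s) (x s) (y s) &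
      exists2 D, 0 < D & - 2 * x s * D = H s] &
    \forall s \near s0, {for s, continuous d2} -> {for s, continuous d1} ->
      {for s, continuous d0} -> {for s, continuous x} /\ {for s, continuous y}].
Proof.
move=> w0 d1w H0.
have w2 : 0 < w ^+ 2 by rewrite exprn_even_gt0.
have pos : 0 < d1 s0 + d2 s0 ^+ 2 by rewrite d1w ltr_wpDr // sqr_ge0.
have [P [P0 PE cP]] := pair_sum cd2 cd1 (continuous_H cd2 cd1 cd0) H0 pos.
pose Q s := d1 s - P s * (d2 s - P s).
pose disc s := Q s - P s ^+ 2 / 4.
have disc0 : disc s0 = w ^+ 2 by rewrite /disc /Q P0 d1w expr0n /= !mul0r !subr0.
pose x s := - P s / 2.
(* The sign of [w] selects the prescribed member of the conjugate pair. *)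
pose y s := Num.sg w * Num.sqrt (disc s).
have cdisc s : {for s, continuous d2} -> {for s, continuous d1} ->
    {for s, continuous P} -> {for s, continuous disc}.
  move=> c2 c1 c; apply: cvgB.
    by apply: cvgB => //; apply: cvgM => //; exact: cvgB.
  apply: cvgM; last exact: cvg_cst.
  by apply: (@continuous_comp _ _ _ P (fun x => x ^+ 2)) => //; exact: exprn_continuous.
have {}cP : \forall s \near s0, {for s, continuous d2} -> {for s, continuous d1} ->
      {for s, continuous d0} -> {for s, continuous P}.
  near=> s => c2 c1 c0; have : {for s, continuous d2} -> {for s, continuous d1} ->
    {for s, continuous H} -> {for s, continuous P} by near: s.
  by apply => //; exact: continuous_H.
have cP0 : {for s0, continuous P} by exact: (nbhs_singleton cP).
have near_disc : \forall s \near s0, 0 < disc s.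
  apply: (cvgr_gt _ (cdisc s0 cd2 cd1 cP0)); by rewrite disc0.
exists x, y; split.
- by rewrite /x P0 oppr0 mul0r.
- by rewrite /y disc0 sqrtr_sqr mulr_sg_norm.
- near=> s.
  have ds : 0 < disc s by near: s.
  have Es : P s * (d1 s + (d2 s - P s) ^+ 2) = H s by near: s.
  have d1s : 0 < d1 s by near: s; apply: (cvgr_gt _ cd1); rewrite d1w.
  have y2 : y s ^+ 2 = disc s.
    by rewrite /y exprMn sqr_sg w0 mul1r sqr_sqrtr // ltW.
  split.
  + by rewrite /y mulf_neq0 ?sgr_eq0 // gt_eqF // sqrtr_gt0.
  + apply: (pair_cubic_root Es (Q := Q s)) => //; split; last by rewrite /x; field.
    by rewrite y2 /disc /x; field.
  + exists (d1 s + (d2 s - P s) ^+ 2); first by rewrite ltr_wpDr // sqr_ge0.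
    by rewrite -Es /x; field.
- near=> s => c2 c1 c0.
  have cPs : {for s, continuous P}.
    have : {for s, continuous d2} -> {for s, continuous d1} ->
      {for s, continuous d0} -> {for s, continuous P} by near: s.
    by apply.
  split; first by apply: cvgM; [exact: cvgN|exact: cvg_cst].
  apply: cvgM; first exact: cvg_cst.
  apply: (@continuous_comp _ _ _ disc Num.sqrt); first exact: cdisc.
  exact: sqrt_continuous.
Unshelve. all: by end_near.
Qed.

Variables (n : nat) (B : R -> 'M[R]_n).

Lemma pair_moves_across (w dH : R) : w != 0 -> d1 s0 = w ^+ 2 -> H s0 = 0 ->
  is_derive s0 1 H dH -> dH != 0 ->
  (\forall s \near s0, forall x y, y != 0 ->
    ceigenvalue (B s) (x +i* y)%C <-> cubic_root (d2 s) (d1 s) (d0 s) x y) ->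
  moves_across B s0 (0 +i* w)%C.
Proof.
move=> w0 d1w H0 DH dH0 eigB.
have w2 : 0 < w ^+ 2 by rewrite exprn_even_gt0.
split.
  have [x [y [x0 y0 xy cxy]]] := pair_branch w0 d1w H0.
  have [cx cy] : {for s0, continuous x} /\ {for s0, continuous y}.
    exact: (nbhs_singleton cxy).
  exists (fun s => (x s +i* y s)%C); split=> //; first by rewrite x0 y0.
  near=> s; have [ys cub _] : [/\ y s != 0, cubic_root (d2 s) (d1 s) (d0 s) (x s) (y s) &
      exists2 D, 0 < D & - 2 * x s * D = H s] by near: s.
  have eigs : forall x y, y != 0 ->
    ceigenvalue (B s) (x +i* y)%C <-> cubic_root (d2 s) (d1 s) (d0 s) x y by near: s.
  exact/eigs.
move=> lam [lam0 eig cRe cIm].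
pose x s := complex.Re (lam s); pose y s := complex.Im (lam s).
have x0 : x s0 = 0 by rewrite /x lam0.
have y0 : y s0 = w by rewrite /y lam0.
(* An arbitrary branch stays nonreal near [s0], so its real part satisfies [x * D = H]; no
   uniqueness of branches is needed. *)
pose D s := - 2 * (d1 s + (d2 s + 2 * x s) ^+ 2).
have cD : {for s0, continuous D}.
  apply: cvgM; first exact: cvg_cst.
  apply: cvgD => //.
  apply: (@continuous_comp _ _ _ (fun s => d2 s + 2 * x s) (fun x => x ^+ 2)).
    by apply: cvgD => //; apply: cvgM; [exact: cvg_cst|exact: cRe].
  exact: exprn_continuous.
have D0 : D s0 < 0.
  by rewrite /D nmulr_rlt0 ?oppr_lt0 // d1w ltr_wpDr // sqr_ge0.
exists (dH / D s0); first by rewrite mulf_neq0 // invr_eq0 lt_eqF.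
apply: (is_derive_quotient (H := H)) => //; last by rewrite lt_eqF.
near=> s.
have ys : y s != 0 by near: s; apply: (cvgr_neq0 _ cIm); rewrite -/(y s0) y0.
have eigs : forall x y, y != 0 ->
    ceigenvalue (B s) (x +i* y)%C <-> cubic_root (d2 s) (d1 s) (d0 s) x y by near: s.
have : ceigenvalue (B s) (lam s) by near: s.
have -> : lam s = (x s +i* y s)%C by rewrite /x /y; case: (lam s).
move/(eigs _ _ ys)/(cubic_root_pair ys); rewrite /H => <-.
by rewrite /D -/(x s); ring.
Unshelve. all: by end_near.
Qed.

(** The larger real root of [X^2 + d2 X + d1] when the discriminant is nonnegative; for [d2 > 0] it
    is the one passing through 0 with [d1]. *)
Definition small_root (d2 d1 : R) : R := - d2 / 2 + Num.sqrt (d2 ^+ 2 / 4 - d1).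

Lemma continuous_small_root s : {for s, continuous d2} -> {for s, continuous d1} ->
  {for s, continuous (fun s => small_root (d2 s) (d1 s))}.
Proof.
move=> c2 c1; apply: cvgD.
  by apply: cvgM; [exact: cvgN|exact: cvg_cst].
apply: (@continuous_comp _ _ _ (fun s => d2 s ^+ 2 / 4 - d1 s) Num.sqrt); last first.
  exact: sqrt_continuous.
apply: cvgB => //; apply: cvgM; last exact: cvg_cst.
by apply: (@continuous_comp _ _ _ d2 (fun x => x ^+ 2)) => //; exact: exprn_continuous.
Qed.

Lemma small_root0 (e2 : R) : 0 <= e2 -> small_root e2 0 = 0.
Proof.
move=> e20; rewrite /small_root subr0.
have -> : e2 ^+ 2 / 4 = (e2 / 2) ^+ 2 by field.
by rewrite sqrtr_sqr ger0_norm ?divr_ge0 // mulNr addNr.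
Qed.

Lemma small_rootP (e2 e1 : R) : 0 <= e2 ^+ 2 / 4 - e1 ->
  small_root e2 e1 * (small_root e2 e1 + e2) = - e1.
Proof.
move=> disc.
have -> : small_root e2 e1 * (small_root e2 e1 + e2) =
    Num.sqrt (e2 ^+ 2 / 4 - e1) ^+ 2 - e2 ^+ 2 / 4.
  by rewrite /small_root; field.
by rewrite sqr_sqrtr //; ring.
Qed.

Lemma zero_moves_across (sg dd : R) : sg < 0 -> 0 < d2 s0 -> d1 s0 = 0 ->
  is_derive s0 1 d1 dd -> dd != 0 ->
  (\forall s \near s0, forall x y,
    ceigenvalue (B s) (x +i* y)%C <-> (x = sg /\ y = 0) \/ quad_root (d2 s) (d1 s) x y) ->
  moves_across B s0 0.
Proof.
move=> sg0 d2_0 d1_0 Dd1 dd0 eigB; split.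
  exists (fun s => (small_root (d2 s) (d1 s) +i* 0)%C); split.
  - by rewrite d1_0 small_root0 // ltW.
  - near=> s.
    have disc : 0 <= d2 s ^+ 2 / 4 - d1 s.
      apply: ltW; near: s; apply: (@cvgr_gt _ _ _ _ _ (d2 s0 ^+ 2 / 4 - d1 s0)).
        apply: cvgB => //; apply: cvgM; last exact: cvg_cst.
        by apply: (@continuous_comp _ _ _ d2 (fun x => x ^+ 2)) => //; exact: exprn_continuous.
      by rewrite d1_0 subr0 divr_gt0 // exprn_gt0.
    have eigs : forall x y, ceigenvalue (B s) (x +i* y)%C <->
      (x = sg /\ y = 0) \/ quad_root (d2 s) (d1 s) x y by near: s.
    apply/eigs; right; split; last by rewrite mulr0.
    have E := small_rootP disc.
    by rewrite expr0n subr0 -[RHS](subrr (- d1 s)) -{1}E; ring.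
  - exact: continuous_small_root.
  - exact: cvg_cst.
move=> lam [lam0 eig cRe cIm].
pose x s := complex.Re (lam s); pose y s := complex.Im (lam s).
have x0 : x s0 = 0 by rewrite /x lam0.
have cD : {for s0, continuous (fun s => - (x s + d2 s))} by apply: cvgN; apply: cvgD.
have D0 : - (x s0 + d2 s0) != 0 by rewrite x0 add0r oppr_eq0 gt_eqF.
exists (dd / - (x s0 + d2 s0)); first by rewrite mulf_neq0 // invr_eq0.
apply: (is_derive_quotient (H := d1)) cD _ _ => //.
near=> s.
(* Close to 0 the branch differs from the eigenvalue [sg], and [2 x + d2 > 0] forces it to be real;
   then [x (x + d2) = - d1]. *)
have xs : sg < x s by near: s; apply: (cvgr_gt _ cRe); rewrite -/(x s0) x0.
have xd : 0 < 2 * x s + d2 s.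
  near: s; apply: (@cvgr_gt _ _ _ _ _ (2 * x s0 + d2 s0)).
    by apply: cvgD => //; apply: cvgM; [exact: cvg_cst|exact: cRe].
  by rewrite x0 mulr0 add0r.
have eigs : forall x y, ceigenvalue (B s) (x +i* y)%C <->
  (x = sg /\ y = 0) \/ quad_root (d2 s) (d1 s) x y by near: s.
have : ceigenvalue (B s) (lam s) by near: s.
have -> : lam s = (x s +i* y s)%C by rewrite /x /y; case: (lam s).
move/eigs => [[xE _]|[Ex /eqP]]; first by rewrite xE ltxx in xs.
rewrite mulf_eq0 gt_eqF //= => /eqP ys; move: Ex; rewrite ys => Ex.
by rewrite -[RHS]subr0 -Ex -/(x s); ring.
Unshelve. all: by end_near.
Qed.

(* A double zero eigenvalue: with P, Q the coefficients of the quadratic factor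
   carrying it, P = (s - s0) f and Q = (s - s0)^2 q, so its roots are (s - s0)
   times those of X^2 + f X + q; the larger real part in absolute value never
   vanishes. *)
Lemma double_zero_branch (dH : R) (k : R -> R) : 0 < d2 s0 -> d1 s0 = 0 ->
  {for s0, continuous k} -> (\forall s \near s0, d0 s = k s * (s - s0) ^+ 2) ->
  is_derive s0 1 H dH -> dH != 0 ->
  (\forall s \near s0, forall x y, cubic_root (d2 s) (d1 s) (d0 s) x y ->
    ceigenvalue (B s) (x +i* y)%C) ->
  exists2 lam, eigenbranch B s0 0 lam & nonzero_Re_speed lam s0.
Proof.
move=> d2_0 d1_0 ck d0E DH dH0 eigB.
have d0_0 : d0 s0 = 0 by rewrite (nbhs_singleton d0E) subrr expr0n mulr0.
have H0 : H s0 = 0 by rewrite /H d1_0 d0_0 mul0r subrr.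
have pos : 0 < d1 s0 + d2 s0 ^+ 2 by rewrite d1_0 add0r exprn_gt0.
have [P [P0 PE cPn]] := pair_sum cd2 cd1 (continuous_H cd2 cd1 cd0) H0 pos.
have cP : {for s0, continuous P}.
  exact: (nbhs_singleton cPn cd2 cd1 (continuous_H cd2 cd1 cd0)).
have cdP : {for s0, continuous (fun s => d2 s - P s)} by exact: cvgB.
pose D s := d1 s + (d2 s - P s) ^+ 2.
have cD : {for s0, continuous D}.
  apply: cvgD => //.
  apply: (@continuous_comp _ _ _ (fun s => d2 s - P s) (fun x => x ^+ 2)) => //.
  exact: exprn_continuous.
have D0 : 0 < D s0 by rewrite /D P0 subr0.
have DP : is_derive s0 1 P (dH / D s0).
  by apply: (is_derive_quotient (H := H)) => //; rewrite gt_eqF.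
have [f [fE cf f0]] := (is_derive1_caratheodory _ _ _).1 DP.
have f00 : f s0 != 0 by rewrite f0 mulf_neq0 // invr_eq0 gt_eqF.
pose q s := k s / (d2 s - P s).
have cq : {for s0, continuous q}.
  by apply: cvgM => //; apply: cvgV => //; rewrite P0 subr0 gt_eqF.
pose disc s := f s ^+ 2 / 4 - q s.
have cdisc : {for s0, continuous disc}.
  apply: cvgB => //; apply: cvgM; last exact: cvg_cst.
  by apply: (@continuous_comp _ _ _ f (fun x => x ^+ 2)) => //; exact: exprn_continuous.
(* The sign of [f s0] makes both summands of [X s0] point the same way. As square roots of negative
   numbers are 0, the formulas for [X] and [Y] cover real and nonreal roots alike. *)
pose X s := - f s / 2 - Num.sg (f s0) * Num.sqrt (disc s).
pose Y s := Num.sqrt (- disc s).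
have cX : {for s0, continuous X}.
  apply: cvgB; first by apply: cvgM; [exact: cvgN|exact: cvg_cst].
  apply: cvgM; first exact: cvg_cst.
  by apply: (@continuous_comp _ _ _ disc Num.sqrt) => //; exact: sqrt_continuous.
have cY : {for s0, continuous Y}.
  apply: (@continuous_comp _ _ _ (fun s => - disc s) Num.sqrt).
    exact: cvgN.
  exact: sqrt_continuous.
have XY s : quad_root (f s) (q s) (X s) (Y s).
  rewrite /X /Y; have [d|d] := leP 0 (disc s).
    rewrite (@ler0_sqrtr _ (- disc s)) ?oppr_le0 //; split; last by rewrite mulr0.
    have sg2 : Num.sg (f s0) ^+ 2 = 1 by rewrite sqr_sg f00.
    have -> : q s = f s ^+ 2 / 4 - Num.sg (f s0) ^+ 2 * Num.sqrt (disc s) ^+ 2.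
      by rewrite sg2 mul1r sqr_sqrtr // /disc; ring.
    by field.
  rewrite (ltr0_sqrtr d) mulr0 subr0; split; last by field.
  by rewrite sqr_sqrtr ?oppr_ge0 ?ltW // /disc; field.
have X0 : X s0 != 0.
  have : Num.sg (f s0) * X s0 < 0.
    have -> : Num.sg (f s0) * X s0 =
        - (Num.sg (f s0) * f s0) / 2 - Num.sg (f s0) ^+ 2 * Num.sqrt (disc s0).
      by rewrite /X; ring.
    have n0 : 0 < `|f s0| by rewrite normr_gt0.
    have S0 := sqrtr_ge0 (disc s0).
    by rewrite sqr_sg f00 mul1r -normrEsg; lra.
  by apply: contraTneq => ->; rewrite mulr0 ltxx.
pose x s := (s - s0) * X s; pose y s := (s - s0) * Y s.
have clin : {for s0, continuous (fun s => s - s0)}.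
  by apply: cvgB; [exact: cvg_id|exact: cvg_cst].
exists (fun s => (x s +i* y s)%C).
  split => /=.
  - by rewrite /x /y subrr !mul0r.
  - near=> s.
    have : forall x y, cubic_root (d2 s) (d1 s) (d0 s) x y ->
      ceigenvalue (B s) (x +i* y)%C by near: s.
    apply.
    have Es : P s * (d1 s + (d2 s - P s) ^+ 2) = H s by near: s.
    apply: (pair_cubic_root Es (Q := d1 s - P s * (d2 s - P s))) => //.
    have dPs : d2 s - P s != 0.
      by near: s; apply: (cvgr_neq0 _ cdP); rewrite P0 subr0 gt_eqF.
    have d0s : d0 s = k s * (s - s0) ^+ 2 by near: s.
    have -> : d1 s - P s * (d2 s - P s) = (s - s0) ^+ 2 * q s.
      apply: (mulIf dPs); rewrite /q.
      transitivity (d0 s); last by rewrite d0s; field.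
      transitivity (d1 s * d2 s - P s * (d1 s + (d2 s - P s) ^+ 2)); first ring.
      by rewrite Es /H; ring.
    have Ps : P s = (s - s0) * f s by rewrite mulrC -fE P0 subr0.
    have [Ex Ey] := XY s; rewrite Ps /x /y; split.
      transitivity ((s - s0) ^+ 2 * (X s ^+ 2 - Y s ^+ 2 + f s * X s + q s)); first ring.
      by rewrite Ex mulr0.
    transitivity ((s - s0) ^+ 2 * ((2 * X s + f s) * Y s)); first ring.
    by rewrite Ey mulr0.
  - by apply: cvgM.
  - by apply: cvgM.
exists (X s0) => //.
apply/is_derive1_caratheodory; exists X; split=> // z.
by rewrite /= /x subrr mul0r subr0 mulrC.
Unshelve. all: by end_near.
Qed.

End Family.
End CubicPairs.

(** * Rays and tangents *)

Section GainGeometry.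
Variables (R : realType) (a b k l : R).
Hypotheses (a_pos : 0 < a) (k_pos : 0 < k) (l_pos : 0 < l).

Let F (e : R * R) := numer a b k l e.1 - e.2 * denom a b k e.1.

Lemma gain_region_bounded : b < 0 -> bounded_set (gain_region a b k l).
Proof.
move=> b0; have := (a_pos, k_pos, l_pos) => -[[a0 k0] l0].
(* [M] bounds the first gain through the trace. For the second, [y * a <= y * denom x < numer x <= k
   * (a * M)]; the norm of a pair is the maximum, hence the sum as a common bound. *)
pose M := - k / b.
have M0 : 0 < M by rewrite ltr_ndivlMr // mul0r oppr_lt0.
exists (M + k * M); split; first exact: num_real.
move=> N MN [x y] [[/= x0 y0]] /= kx h; rewrite (le_trans _ (ltW MN)) //.
have xM : x < M by rewrite /M ltr_ndivlMr // -subr_gt0 opprK addrC mulrC.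
have kM : 0 < k * M by rewrite mulr_gt0.
have yM : y <= k * M.
  have kxk : k + b * x <= k by rewrite gerDl nmulr_rle0.
  have dN : a <= denom a b k x by rewrite /denom lerDl oppr_ge0 nmulr_rle0 // ltW.
  have h1 : y * a <= y * denom a b k x by rewrite ler_wpM2l.
  have h2 : numer a b k l x <= k * (a * M).
    rewrite /numer; have [ax|ax] := leP 0 (a * x - l); last first.
      by rewrite (le_trans (ltW _) (mulr_ge0 (ltW k0) (mulr_ge0 (ltW a0) (ltW M0)))) // pmulr_rlt0.
    have aM : a * x <= a * M by rewrite ler_pM2l // ltW.
    by rewrite ler_pM // ?(ltW kx) //; lra.
  rewrite subr_gt0 in h; rewrite -(ler_pM2r a0) (le_trans h1) // (le_trans (ltW h)) //.
  by rewrite -mulrA [M * a]mulrC.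
have xb : x <= M + k * M by rewrite (le_trans (ltW xM)) // lerDl ltW.
have yb : y <= M + k * M by rewrite (le_trans yM) // lerDr ltW.
by rewrite /Num.norm /= ge_max !ger0_norm // xb.
Qed.

(** * Intersections of a ray with the curve *)

Section Ray.
Variables (er ep : R).
Hypotheses (b_ge0 : 0 <= b) (er_pos : 0 < er) (ep_ge0 : 0 <= ep).
(** Along the ray the Routh function is [A s^2 + B s - l k]. As [A >= 0] and the constant term is
    negative, there is at most one positive root. *)
Let A := b * er * (a * er + b * ep).
Let B := k * (a * er + b * ep) - l * b * er - a * ep.

Let A_ge0 : 0 <= A.
Proof. by rewrite mulr_ge0 ?addr_ge0 ?mulr_ge0 // ltW. Qed.

Let F_ray s : F (s * er, s * ep) = A * s ^+ 2 + B * s - l * k.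
Proof. by rewrite /F /numer /denom /A /B /=; ring. Qed.

(** Vieta's formula gives the cofactor; in this form it stays valid when [A = 0]. *)
Lemma ray_factor s1 s : s1 != 0 -> F (s1 * er, s1 * ep) = 0 ->
  F (s * er, s * ep) = (s - s1) * (A * s + l * k / s1).
Proof.
rewrite !F_ray => s10 /eqP; rewrite subr_eq0 => /eqP E.
have -> : l * k / s1 = A * s1 + B by rewrite -E; field.
by rewrite -E; ring.
Qed.

Lemma ray_cofactor_gt0 s1 s : 0 < s1 -> 0 <= s -> 0 < A * s + l * k / s1.
Proof.
by move=> s10 s0; rewrite ltr_wpDl ?(mulr_ge0 A_ge0) // divr_gt0 // mulr_gt0.
Qed.

Lemma ray_root : 0 < A \/ 0 < B -> exists2 s1, 0 < s1 & F (s1 * er, s1 * ep) = 0.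
Proof.
move=> AB; have lk : 0 < l * k by rewrite mulr_gt0.
pose d := Num.sqrt (B ^+ 2 + 4 * A * (l * k)).
have A4 : 0 <= 4 * A * (l * k) by rewrite (mulr_ge0 (mulr_ge0 _ A_ge0) (ltW lk)).
have d2 : d ^+ 2 = B ^+ 2 + 4 * A * (l * k) by rewrite sqr_sqrtr // addr_ge0 // sqr_ge0.
have d0 : 0 <= d by exact: sqrtr_ge0.
have Bd : 0 < B + d.
  have [B0|B0] := ltP 0 B; first by rewrite ltr_wpDr.
  have A0 : 0 < A by case: AB => // ?; lra.
  have A40 : 0 < 4 * A * (l * k) by rewrite (mulr_gt0 (mulr_gt0 _ A0) lk).
  rewrite ltNge; apply/negP => Bd.
  have : d ^+ 2 <= B ^+ 2 by rewrite -[B ^+ 2]sqrrN ler_sqr ?nnegrE; lra.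
  by rewrite d2 => ?; lra.
(* The quadratic formula with rationalized numerator, which also covers [A = 0]. *)
exists (2 * (l * k) / (B + d)); first by rewrite divr_gt0 // mulr_gt0.
rewrite F_ray; have Bd0 : B + d != 0 by rewrite gt_eqF.
have -> : A * (2 * (l * k) / (B + d)) ^+ 2 + B * (2 * (l * k) / (B + d)) - l * k =
   l * k * (B ^+ 2 + 4 * A * (l * k) - d ^+ 2) / (B + d) ^+ 2 by field.
by rewrite d2 subrr mulr0 mul0r.
Qed.

Lemma ray_root_of_pos s : 0 <= s -> 0 < F (s * er, s * ep) ->
  exists2 s1, 0 < s1 < s & F (s1 * er, s1 * ep) = 0.
Proof.
move=> s0 Fs; have lk : 0 < l * k by rewrite mulr_gt0.
have [s1 s10 E] : exists2 s1, 0 < s1 & F (s1 * er, s1 * ep) = 0.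
  apply: ray_root; have := A_ge0; rewrite le_eqVlt => /orP[/eqP A0|]; last by left.
  right; rewrite ltNge; apply/negP => B0.
  by move: Fs; rewrite F_ray -A0 mul0r add0r ltNge; have : B * s <= 0; [exact: mulr_le0_ge0|lra].
exists s1 => //; rewrite s10 /=; move: Fs.
by rewrite (ray_factor _ (lt0r_neq0 s10) E) pmulr_lgt0 ?ray_cofactor_gt0 // subr_gt0.
Qed.

Lemma ray_root_ex : 0 < b \/ ep < k * er ->
  exists2 s1, 0 < s1 & F (s1 * er, s1 * ep) = 0.
Proof.
move=> H; apply: ray_root; have := b_ge0.
rewrite le_eqVlt => /orP[/eqP b0|b0].
  right; case: H; first by rewrite -b0 ltxx.
  move=> H; have -> : B = a * (k * er - ep) by rewrite /B -b0; ring.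
  by rewrite mulr_gt0 // subr_gt0.
by left; rewrite /A !mulr_gt0 // ltr_wpDr ?mulr_ge0 ?mulr_gt0 // ltW.
Qed.

Lemma ray_root_uniq s1 s : 0 < s1 -> F (s1 * er, s1 * ep) = 0 -> 0 < s ->
  F (s * er, s * ep) = 0 -> s = s1.
Proof.
move=> s10 E s0; rewrite (ray_factor _ (lt0r_neq0 s10) E) => /eqP.
by rewrite mulf_eq0 subr_eq0 orbC gt_eqF ?ray_cofactor_gt0 1?ltW //= => /eqP.
Qed.

End Ray.

(** Partial derivatives of the Routh function: [a c2 + b c1], and minus the denominator. *)
Definition grad1 (x y : R) := a * (k + b * x) + b * (- l + a * x + b * y).
Definition grad2 (x : R) := b * (k + b * x) - a.

(** For [b <= 0] the denominator is positive. For [b > 0], [c2 > 0] and [c1 * c2 = a y >= 0] give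
    [c1 >= 0], so [a c2 + b c1 > 0]. *)
Lemma gain_boundary_grad x y : gain_boundary a b k l (x, y) ->
  grad1 x y != 0 \/ grad2 x != 0.
Proof.
have := (a_pos, k_pos, l_pos) => -[[a0 kp] lp].
move=> -[/= [/= x0 y0] kx E]; rewrite /grad1 /grad2.
have [b0|b0] := leP b 0.
  by right; rewrite lt_eqF // subr_lt0 (le_lt_trans _ a0) // mulr_le0_ge0.
left; have k0 : 0 < k + b * x by rewrite ltr_wpDr // mulr_ge0 // ltW.
have c1 : 0 <= - l + a * x + b * y.
  rewrite -(pmulr_rge0 _ k0).
  have -> : (k + b * x) * (- l + a * x + b * y) = numer a b k l x - y * denom a b k x + a * y.
    by rewrite /numer /denom; ring.
  by rewrite E subrr add0r mulr_ge0 // ltW.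
by rewrite gt_eqF // ltr_wpDr ?mulr_ge0 ?mulr_gt0 // ltW.
Qed.

Lemma tangent_grad (C : set (R * R)) (e w : R * R) :
  (forall q, C q -> F q = 0) -> F e = 0 -> tangent_vector C e w ->
  w.1 * grad1 e.1 e.2 + w.2 * grad2 e.1 = 0.
Proof.
move=> FC Fe [_ [q [h [Ch cq c1 c2]]]].
pose d n := (q n).1 - e.1.
(* This is [(F (q n) - F e) / h n], expanded exactly: [F] is a quadratic polynomial whose
   second-order part contains the first increment as a factor. *)
pose t n := ((q n).1 - e.1) / h n *
   (grad1 e.1 e.2 + b * (a * ((q n).1 - e.1) + b * ((q n).2 - e.2)))
   + ((q n).2 - e.2) / h n * grad2 e.1.
have t0 n : t n = 0.
  have [Cq hn] := Ch n.
  transitivity ((F (q n) - F e) / h n); last by rewrite Fe (FC _ Cq) subrr mul0r.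
  by rewrite /t /F /numer /denom /grad1 /grad2; ring.
have q1 : (q n).1 @[n --> \oo] --> e.1 by apply: (cvg_comp _ _ cq); exact: cvg_fst.
have q2 : (q n).2 @[n --> \oo] --> e.2 by apply: (cvg_comp _ _ cq); exact: cvg_snd.
have ct : t n @[n --> \oo] -->
  w.1 * (grad1 e.1 e.2 + b * (a * (e.1 - e.1) + b * (e.2 - e.2))) + w.2 * grad2 e.1.
  apply: cvgD; apply: cvgM => //; try exact: cvg_cst.
  apply: cvgD; first exact: cvg_cst.
  apply: cvgM; first exact: cvg_cst.
  apply: cvgD; apply: cvgM; try exact: cvg_cst.
    by apply: cvgB => //; exact: cvg_cst.
  by apply: cvgB => //; exact: cvg_cst.
rewrite !subrr !mulr0 addr0 mulr0 addr0 in ct.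
apply: (cvg_unique _ ct) => //.
have -> : t = fun=> 0 by apply/funext.
exact: cvg_cst.
Qed.

End GainGeometry.

Lemma lin_indep_kernel (R : realType) (al be : R) (v w : R * R) :
  al != 0 \/ be != 0 -> lin_indep v w -> w <> (0, 0) ->
  w.1 * al + w.2 * be = 0 -> v.1 * al + v.2 * be != 0.
Proof.
move=> ab li w0 Ew; apply/eqP => Ev.
have det0 : v.1 * w.2 - v.2 * w.1 = 0.
  case: ab => n0; apply: (mulIf n0); rewrite mul0r.
    have -> : (v.1 * w.2 - v.2 * w.1) * al =
      (v.1 * al + v.2 * be) * w.2 - v.2 * (w.1 * al + w.2 * be) by ring.
    by rewrite Ev Ew; ring.
  have -> : (v.1 * w.2 - v.2 * w.1) * be =
      v.1 * (w.1 * al + w.2 * be) - (v.1 * al + v.2 * be) * w.1 by ring.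
  by rewrite Ev Ew; ring.
have [|| w2 _] := li w.2 (- v.2); first by rewrite -[RHS]det0; ring.
  by ring.
have [||w1 _] := li w.1 (- v.1); first by ring.
  by rewrite -[RHS]oppr0 -[in RHS]det0; ring.
by apply: w0; rewrite (surjective_pairing w) w1 w2.
Qed.

Lemma nonneg_derive0 (R : realType) (f : R -> R) s0 d :
  f s0 = 0 -> (\forall s \near s0, 0 <= f s) -> is_derive s0 1 f d -> d = 0.
Proof.
move=> f0 fge /is_derive1_caratheodory [G [GE cG <-]].
have fE s : f s = G s * (s - s0) by rewrite -GE f0 subr0.
apply/eqP; rewrite eq_le; apply/andP; split; rewrite leNgt; apply/negP => G0.
  have Gpos : \forall s \near s0, 0 < G s by exact: (cvgr_gt _ cG).
  have : \forall s \near s0^'-, False.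
    near=> s.
    have ss : s < s0 by near: s; exact: nbhs_left_lt.
    have Gs : 0 < G s by near: s; apply: (cvg_at_left_filter cvg_id).
    have : 0 <= f s by near: s; exact: (cvg_at_left_filter cvg_id).
    by rewrite fE leNgt pmulr_rlt0 // subr_lt0 ss.
  by move/(@filter_ex _ s0^'- _) => [].
have Gneg : \forall s \near s0, G s < 0 by exact: (cvgr_lt _ cG).
have : \forall s \near s0^'+, False.
  near=> s.
  have ss : s0 < s by near: s; exact: nbhs_right_gt.
  have Gs : G s < 0 by near: s; apply: (cvg_at_right_filter cvg_id).
  have : 0 <= f s by near: s; exact: (cvg_at_right_filter cvg_id).
  by rewrite fE leNgt nmulr_rlt0 // subr_gt0 ss.
by move/(@filter_ex _ s0^'+ _) => [].
Unshelve. all: by end_near.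
Qed.

(** * The thruster model *)

Section Thruster.
Variables (R : realType) (p : params R) (u0 xT : R).
Hypotheses (M_unit : mass_mx p \in unitmx) (m_pos : 0 < mass p + m_uu p).
Hypothesis k21_pos : 0 < k21 p u0.
Hypothesis surge_neg : surge_eig p u0 < 0.
Hypotheses (k02_pos : 0 < k02 p u0) (k01_pos : 0 < k01 p u0).

Let a := k10 p u0 - k11 p u0 * xT.
Let b := k20 p u0 - k21 p u0 * xT.
Let k := k02 p u0.
Let l := k01 p u0.

Lemma routhE e : routh p u0 xT e = numer a b k l e.1 - e.2 * denom a b k e.1.
Proof. by rewrite /routh /c0 /c1 /c2 /numer /denom /a /b /k /l; ring. Qed.

Lemma curveCE e : curveC p u0 xT e <-> routh p u0 xT e = 0.
Proof.
rewrite /curveC /routh /=; split=> [->|/eqP]; first by rewrite subrr.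
by rewrite subr_eq0 => /eqP.
Qed.

Lemma stabilizable_gains e : quadrant e -> stabilized p u0 xT e ->
  0 < a /\ 0 < a * k + b * l.
Proof.
have := (k02_pos, k01_pos) => -[kp lp].
case=> x0 y0 /stabilizedP => /(_ M_unit m_pos k21_pos surge_neg) [t_pos h_pos c0_pos].
have c0_ge0 : 0 <= c0 p u0 xT e.
  have [y1|y1] := eqVneq e.2 0; first by rewrite /c0 y1 mulr0.
  by rewrite ltW // c0_pos.
have c1_pos : 0 < c1 p u0 xT e by rewrite -(pmulr_lgt0 _ t_pos) (le_lt_trans c0_ge0) // -subr_gt0.
have a_pos : 0 < a.
  have [y1|y1] := eqVneq e.2 0.
    move: c1_pos; rewrite /c1 y1 mulr0 addr0 -/a addrC subr_gt0 => H.
    rewrite ltNge; apply/negP => a0.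
    by have := lt_trans lp H; rewrite ltNge mulr_le0_ge0.
  by move: (c0_pos y1); rewrite /c0 pmulr_lgt0 // lt0r y1.
split=> //; have [b0|b0] := leP 0 b.
  exact: ltr_wpDr (mulr_ge0 b0 (ltW lp)) (mulr_gt0 a_pos kp).
(* For [b < 0], [c1 > 0] gives [l < a x], and therefore [a k + b l > a k + b (a x) = a c2 > 0]. *)
have ax : l < a * e.1.
  have by0 : b * e.2 <= 0 by rewrite mulr_le0_ge0 // ltW.
  have : 0 < - l + a * e.1 by rewrite (lt_le_trans c1_pos) // gerDl.
  by rewrite addrC subr_gt0.
have ak : 0 < a * (k + b * e.1) by rewrite mulr_gt0.
have : b * (a * e.1) < b * l by rewrite ltr_nM2l.
rewrite -(ltrD2l (a * k)); apply: le_lt_trans; rewrite ltW //.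
by have -> : a * k + b * (a * e.1) = a * (k + b * e.1) by ring.
Qed.

Lemma stability_regionE : 0 < a -> stability_region p u0 xT = gain_region a b k l.
Proof.
move=> a_pos; apply/seteqP; split=> e.
  case=> Qe /stabilizedP => /(_ M_unit m_pos k21_pos surge_neg) [? ? _].
  by split; rewrite // -routhE.
case=> Qe tr h; split=> //; apply/stabilizedP => //; split; rewrite ?routhE // => y0.
by case: Qe => _ y1; rewrite /c0 mulr_gt0 // lt0r y0.
Qed.

Lemma stability_boundaryE : 0 < a -> 0 < a * k + b * l ->
  stability_boundary p u0 xT = gain_boundary a b k l.
Proof.
by move=> a_pos w_pos; rewrite /stability_boundary stability_regionE // gain_boundaryE.
Qed.

Let eigA e x y := A_eigP xT M_unit m_pos k21_pos e x y.
Let eigS e x y := @S_eigP _ _ _ xT M_unit m_pos k21_pos e x y.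

(** * Loss and gain of stability along rays *)

Section RightHalfPlane.
Hypotheses (a_pos : 0 < a) (b_ge0 : 0 <= b).

Let ray_trace (x : R) : 0 <= x -> 0 < k + b * x.
Proof. by move=> x0; rewrite ltr_wpDr // mulr_ge0. Qed.

Lemma ray_curve (er ep : R) : 0 < er -> 0 <= ep -> 0 < b \/ ep < k * er ->
  exists2 s1 : R, 0 < s1 & forall s : R, 0 < s ->
    (curveC p u0 xT (s * er, s * ep) <-> s = s1).
Proof.
move=> er0 ep0 H.
have [s1 s10 E] := ray_root_ex a_pos k02_pos k01_pos b_ge0 er0 ep0 H.
exists s1 => // s s0; rewrite curveCE routhE; split=> [Es|->] //.
exact: (ray_root_uniq a_pos k02_pos k01_pos b_ge0 er0 ep0 s10 E s0 Es).
Qed.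

Lemma ray_sign (er ep s1 s : R) : 0 < er -> 0 <= ep -> 0 < s1 -> 0 <= s ->
  curveC p u0 xT (s1 * er, s1 * ep) ->
  exists2 q, 0 < q & routh p u0 xT (s * er, s * ep) = (s - s1) * q.
Proof.
move=> er0 ep0 s10 s0 /curveCE; rewrite !routhE => E.
rewrite (ray_factor _ (lt0r_neq0 s10) E); eexists; last reflexivity.
exact: (ray_cofactor_gt0 a_pos k02_pos k01_pos b_ge0 er0 ep0 s10 s0).
Qed.

Lemma ray_stabilized (er ep s : R) : 0 < er -> 0 <= ep -> 0 <= s ->
  stabilized p u0 xT (s * er, s * ep) <->
  exists2 s1 : R, 0 < s1 < s & curveC p u0 xT (s1 * er, s1 * ep).
Proof.
move=> er0 ep0 s0.
have stP := stabilizedP xT M_unit m_pos k21_pos surge_neg (s * er, s * ep).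
split.
  move/stP => [_ + _]; rewrite routhE => h.
  have [s1 s10 E] := ray_root_of_pos a_pos k02_pos k01_pos b_ge0 er0 ep0 s0 h.
  by exists s1 => //; apply/curveCE; rewrite routhE.
case=> s1 /andP[s10 s1s] C; apply/stP.
have [q q0 E] := ray_sign er0 ep0 s10 s0 C.
split=> /=.
- by rewrite /c2 ray_trace // mulr_ge0 // ltW.
- by rewrite E mulr_gt0 // subr_gt0.
- by move=> y0; rewrite /c0 mulr_gt0 // lt0r y0 mulr_ge0.
Qed.


Let continuous_lin (u v w : R) : continuous (fun s : R => u + v * (s * w)).
Proof.
move=> s; apply: cvgD; first exact: cvg_cst.
by apply: cvgM; [exact: cvg_cst|apply: cvgM; [exact: cvg_id|exact: cvg_cst]].
Qed.

Let continuous_c0 er ep : continuous (fun s : R => c0 p u0 xT (s * er, s * ep)).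
Proof.
move=> s; have := @continuous_lin 0 a ep s; rewrite /c0 /=.
by under eq_fun do rewrite add0r.
Qed.

Let continuous_c2 er ep : continuous (fun s : R => c2 p u0 xT (s * er, s * ep)).
Proof. exact: continuous_lin. Qed.

Let continuous_c1 er ep : continuous (fun s : R => c1 p u0 xT (s * er, s * ep)).
Proof.
move=> s; apply: cvgD; first exact: continuous_lin.
by apply: cvgM; [exact: cvg_cst|apply: cvgM; [exact: cvg_id|exact: cvg_cst]].
Qed.

Lemma crosses_downwardP (f : R -> R) s0 : f s0 = 0 ->
  (\forall s \near s0, (s < s0 -> 0 < f s) /\ (s0 < s -> f s < 0)) ->
  crosses_downward f s0.
Proof.
by move=> f0 H; split=> //; rewrite near_withinE; apply: filterS H => s [].
Qed.

Lemma ray_pair_crossing (er ep s1 : R) : 0 < er -> 0 < ep -> 0 < s1 ->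
  curveC p u0 xT (s1 * er, s1 * ep) ->
  exists lam : R -> R[i],
    [/\ \forall s \near s1,
          {for s, continuous (fun s => complex.Re (lam s))} /\
          {for s, continuous (fun s => complex.Im (lam s))},
        \forall s \near s1,
          [/\ ceigenvalue (A_mx p u0 xT (s * er, s * ep)) (lam s),
              ceigenvalue (A_mx p u0 xT (s * er, s * ep)) (conjc (lam s)) &
              complex.Im (lam s) != 0] &
        crosses_downward (fun s => complex.Re (lam s)) s1].
Proof.
move=> er0 ep0 s10 C.
pose e s := (s * er, s * ep).
have tr : 0 < c2 p u0 xT (e s1) by rewrite /c2 /= ray_trace // mulr_ge0 // ltW.
have c0_pos : 0 < c0 p u0 xT (e s1) by rewrite /c0 /= !mulr_gt0.
have c1_pos : 0 < c1 p u0 xT (e s1) by rewrite -(pmulr_lgt0 _ tr) C.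
pose w := Num.sqrt (c1 p u0 xT (e s1)).
have w0 : w != 0 by rewrite gt_eqF // sqrtr_gt0.
have w2 : c1 p u0 xT (e s1) = w ^+ 2 by rewrite sqr_sqrtr // ltW.
have [||||x [y [x0 y0 xy cxy]]] := @pair_branch _ (fun s => c2 p u0 xT (e s))
   (fun s => c1 p u0 xT (e s)) (fun s => c0 p u0 xT (e s)) s1 _ _ _ w w0 w2.
- exact: continuous_c2.
- exact: continuous_c1.
- exact: continuous_c0.
- exact/curveCE.
exists (fun s => (x s +i* y s)%C); split.
- near=> s; have : {for s, continuous (fun s => c2 p u0 xT (e s))} ->
    {for s, continuous (fun s => c1 p u0 xT (e s))} ->
    {for s, continuous (fun s => c0 p u0 xT (e s))} ->
    {for s, continuous x} /\ {for s, continuous y} by near: s.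
  by apply; [exact: continuous_c2|exact: continuous_c1|exact: continuous_c0].
- near=> s; have [ys cub _] : [/\ y s != 0,
    cubic_root (c2 p u0 xT (e s)) (c1 p u0 xT (e s)) (c0 p u0 xT (e s)) (x s) (y s) &
    exists2 D, 0 < D & - 2 * x s * D = routh p u0 xT (e s)] by near: s.
  split=> //; first by apply/eigA; right.
  apply/eigA; right; case: cub => Ex Ey; split; rewrite sqrrN // mulrN Ey oppr0 //.
apply: crosses_downwardP => //=; near=> s.
have s0 : 0 < s by near: s; exact: lt_nbhsr.
have [_ _ [D D0 ED]] : [/\ y s != 0,
    cubic_root (c2 p u0 xT (e s)) (c1 p u0 xT (e s)) (c0 p u0 xT (e s)) (x s) (y s) &
    exists2 D, 0 < D & - 2 * x s * D = routh p u0 xT (e s)] by near: s.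
have [q q0 Eq] := ray_sign er0 (ltW ep0) s10 (ltW s0) C.
have xE : x s = (s1 - s) * (q / (2 * D)).
  apply: (mulIf (lt0r_neq0 D0)); apply: (mulfI (_ : - 2 != 0 :> R)).
    by rewrite oppr_eq0 pnatr_eq0.
  by rewrite mulrA ED Eq; field; rewrite gt_eqF.
have qD : 0 < q / (2 * D) by rewrite divr_gt0 // mulr_gt0.
by split=> ss; rewrite xE ?(pmulr_lgt0 _ qD) ?(pmulr_llt0 _ qD) ?subr_gt0 ?subr_lt0.
Unshelve. all: by end_near.
Qed.

Lemma axis_crossing (er s1 : R) : 0 < er -> 0 < s1 ->
  curveC p u0 xT (s1 * er, 0) ->
  exists mu : R -> R,
    [/\ \forall s \near s1, {for s, continuous mu},
        \forall s \near s1,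
          [/\ eigenvalue (A_mx p u0 xT (s * er, 0)) (mu s),
              eigenvalue (S_mx p u0 xT (s * er, 0)) (mu s) &
              mup (mu s) (char_poly (S_mx p u0 xT (s * er, 0))) = 1%N] &
        crosses_downward mu s1].
Proof.
move=> er0 s10; have e0 s : (s * er, 0) = (s * er, s * 0) by rewrite mulr0.
rewrite e0 => C.
pose d2 s := c2 p u0 xT (s * er, s * 0).
pose d1 s := c1 p u0 xT (s * er, s * 0).
have cd2 : continuous d2 by exact: continuous_c2.
have cd1 : continuous d1 by exact: continuous_c1.
have tr s : 0 <= s -> 0 < d2 s by move=> s0; rewrite /d2 /c2 /= ray_trace // mulr_ge0 // ltW.
have d1E s : d1 s = a * er * (s - s1).
  have d10 : d1 s1 = 0.
    have /eqP : d1 s1 * d2 s1 = 0 by rewrite [LHS]C /c0 /= !mulr0.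
    by rewrite mulf_eq0 (gt_eqF (tr _ (ltW s10))) orbF => /eqP.
  by rewrite -[LHS]subr0 -d10 /d1 /c1 /= -/a; ring.
have d2_s1 := tr _ (ltW s10).
pose mu s := small_root (d2 s) (d1 s).
have cmu : continuous mu by move=> s; exact: continuous_small_root (cd2 s) (cd1 s).
have mu0 : mu s1 = 0 by rewrite /mu d1E subrr mulr0 (small_root0 (ltW d2_s1)).
(* These bounds separate [mu s] from the two other eigenvalues of [S], namely the surge eigenvalue
   and [- (mu s + d2 s)], which makes it simple. *)
have near_mu : \forall s \near s1, [/\ 0 < s, surge_eig p u0 < mu s,
    0 < 2 * mu s + d2 s, 0 < mu s + d2 s &
    mu s * (mu s + d2 s) = - d1 s].
  near=> s; split.
  - by near: s; exact: lt_nbhsr.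
  - by near: s; apply: (cvgr_gt _ (cmu s1)); rewrite mu0.
  - near: s; apply: (@cvgr_gt _ _ _ _ _ (2 * mu s1 + d2 s1)); last by rewrite mu0 mulr0 add0r.
    by apply: cvgD; [apply: cvgM; [exact: cvg_cst|exact: cmu]|exact: cd2].
  - near: s; apply: (@cvgr_gt _ _ _ _ _ (mu s1 + d2 s1)); last by rewrite mu0 add0r.
    by apply: cvgD; [exact: cmu|exact: cd2].
  - apply: small_rootP; apply: ltW; near: s.
    apply: (@cvgr_gt _ _ _ _ _ (d2 s1 ^+ 2 / 4 - d1 s1)); last first.
      by rewrite d1E subrr mulr0 subr0 divr_gt0 // exprn_gt0.
    apply: cvgB; last exact: cd1.
    apply: cvgM; last exact: cvg_cst.
    by apply: (@continuous_comp _ _ _ d2 (fun x => x ^+ 2)); [exact: cd2|exact: exprn_continuous].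
exists mu; split.
- by near=> s; exact: cmu.
- near=> s.
  have [s0 sg m2 m1 E] : [/\ 0 < s, surge_eig p u0 < mu s,
    0 < 2 * mu s + d2 s, 0 < mu s + d2 s &
    mu s * (mu s + d2 s) = - d1 s] by near: s.
  have S_poly : char_poly (S_mx p u0 xT (s * er, 0)) =
     ('X - (surge_eig p u0)%:P) * (('X - (mu s)%:P) * ('X - (- (mu s + d2 s))%:P)).
    rewrite char_poly_S //; congr (_ * _).
    have -> : c1 p u0 xT (s * er, 0) = - (mu s * (mu s + d2 s)) by rewrite E opprK /d1 mulr0.
    have -> : c2 p u0 xT (s * er, 0) = d2 s by rewrite /d2 mulr0.
    by rewrite !(polyCN, polyCM, polyCD); ring.
  have rootS : root (char_poly (S_mx p u0 xT (s * er, 0))) (mu s).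
    by rewrite S_poly !rootM !root_XsubC eqxx orbT.
  split.
  + rewrite eigenvalue_root_char char_poly_A //.
    have -> : 'X^3 + (c2 p u0 xT (s * er, 0))%:P * 'X^2 + (c1 p u0 xT (s * er, 0))%:P * 'X
       + (c0 p u0 xT (s * er, 0))%:P =
       'X * ('X ^+ 2 + (c2 p u0 xT (s * er, 0))%:P * 'X + (c1 p u0 xT (s * er, 0))%:P).
      by rewrite /c0 /= mulr0 polyC0; ring.
    move: rootS; rewrite char_poly_S // !rootM => /orP[->//|->].
    by rewrite !orbT.
  + by rewrite eigenvalue_root_char.
  rewrite S_poly mupMr ?root_XsubC ?gt_eqF // mupMl ?root_XsubC.
    by rewrite -['X - _]expr1 mup_XsubCX eqxx.
  by rewrite -subr_eq0 opprK addrA -mulr2n -mulr_natl gt_eqF.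
apply: crosses_downwardP => //; near=> s.
have [s0 _ _ m1 E] : [/\ 0 < s, surge_eig p u0 < mu s,
    0 < 2 * mu s + d2 s, 0 < mu s + d2 s &
    mu s * (mu s + d2 s) = - d1 s] by near: s.
have ae : 0 < a * er by rewrite mulr_gt0.
split=> ss.
  by rewrite -(pmulr_lgt0 _ m1) E d1E oppr_gt0 pmulr_rlt0 // subr_lt0.
by rewrite -(pmulr_llt0 _ m1) E d1E oppr_lt0 pmulr_rgt0 // subr_gt0.
Unshelve. all: by end_near.
Qed.

End RightHalfPlane.

(** * Transversal crossing of the stability boundary *)

Section Transversal.
Hypotheses (a_pos : 0 < a) (w_pos : 0 < a * k + b * l).

Let Bd := gain_boundary a b k l.

(** Off the axis [c1 c2 = c0 > 0], which leads to an imaginary pair of [A]. On the axis one of [c1],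
    [c2] vanishes and [a k + b l = a c2 - b c1 > 0] makes the other positive, giving a zero
    eigenvalue or an imaginary pair of [S]. *)
Lemma boundary_cases e : Bd e ->
  [\/ [/\ e.2 != 0, 0 < c2 p u0 xT e & 0 < c1 p u0 xT e],
      [/\ e.2 = 0, c2 p u0 xT e = 0 & 0 < c1 p u0 xT e] |
      [/\ e.2 = 0, c1 p u0 xT e = 0 & 0 < c2 p u0 xT e]].
Proof.
case: e => x y [/= [/= x0 y0] t0 /eqP]; rewrite -subr_eq0.
rewrite -(routhE (x, y)) /routh subr_eq0 => /eqP E.
have [y1|y1] := eqVneq y 0.
  have wE : a * k + b * l = a * c2 p u0 xT (x, y) - b * c1 p u0 xT (x, y).
    by rewrite /c1 /c2 -/a -/b -/k -/l y1 /=; ring.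
  have /eqP : c1 p u0 xT (x, y) * c2 p u0 xT (x, y) = 0 by rewrite E /c0 y1 mulr0.
  rewrite mulf_eq0 => /orP[] /eqP c.
    apply: Or33; split=> //; rewrite -(pmulr_rgt0 _ a_pos).
    by move: w_pos; rewrite wE c mulr0 subr0.
  have b0 : b < 0.
    rewrite ltNge; apply/negP => b0.
    by have := ltr_wpDr (mulr_ge0 b0 x0) k02_pos; rewrite [X in 0 < X]c ltxx.
  by apply: Or32; split=> //; move: w_pos; rewrite wE c mulr0 sub0r oppr_gt0 nmulr_rlt0.
have c0_pos : 0 < c0 p u0 xT (x, y) by rewrite /c0 mulr_gt0 // lt0r y1.
have t1 : 0 < c2 p u0 xT (x, y).
  rewrite lt0r [0 <= _]t0 andbT; apply: contraTneq c0_pos => c.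
  by rewrite -E c mulr0 ltxx.
by apply: Or31; split=> //; rewrite -(pmulr_lgt0 _ t1) E.
Qed.

Lemma critical_exists e : Bd e -> exists z, critical_eigenvalue p u0 xT e z.
Proof.
move=> Be; have [_ _ /eqP] := Be; rewrite -subr_eq0 -routhE /routh subr_eq0 => /eqP h.
case: (boundary_cases Be) => -[y1 d2 d1].
- exists (0 +i* Num.sqrt (c1 p u0 xT e))%C; split=> //; rewrite (negPf y1).
  have E : Num.sqrt (c1 p u0 xT e) ^+ 2 = c1 p u0 xT e by rewrite sqr_sqrtr // ltW.
  by apply/eigA; right; split; rewrite E ?expr0n /= -?h; ring.
- exists (0 +i* Num.sqrt (c1 p u0 xT e))%C; split=> //; rewrite y1 eqxx.
  have E : Num.sqrt (c1 p u0 xT e) ^+ 2 = c1 p u0 xT e by rewrite sqr_sqrtr // ltW.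
  by apply/eigS => //; right; split; rewrite ?E ?d2 ?expr0n /=; ring.
- exists (0 +i* 0)%C; split=> //; rewrite y1 eqxx.
  by apply/eigS => //; right; split; rewrite ?d2 ?expr0n /=; ring.
Qed.

Lemma critical_cases e z : Bd e -> critical_eigenvalue p u0 xT e z ->
  exists w, z = (0 +i* w)%C /\
    ([/\ w != 0, c1 p u0 xT e = w ^+ 2 & e.2 = 0 -> c2 p u0 xT e = 0] \/
     [/\ w = 0, e.2 = 0, c1 p u0 xT e = 0 & 0 < c2 p u0 xT e]).
Proof.
case: z => x w Be [/= -> H]; exists w; split=> //.
have [_ _ /eqP] := Be; rewrite -subr_eq0 -routhE /routh subr_eq0 => /eqP h.
have sgN0 : 0 <> surge_eig p u0 by move=> E; move: surge_neg; rewrite -E ltxx.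
case: (boundary_cases Be) => -[y1 d2 d1].
- move: H; rewrite (negPf y1) => /eigA [[/sgN0//]|[Ex /eqP]].
  have w0 : w != 0.
    apply: contraTneq (mulr_gt0 d1 d2) => w0.
    have c00 : c0 p u0 xT e = 0 by rewrite -[RHS]Ex w0; ring.
    by rewrite h c00 ltxx.
  rewrite mulf_eq0 (negPf w0) orbF => /eqP Ey.
  left; split=> // [|y0]; last by rewrite y0 eqxx in y1.
  by apply/eqP; rewrite -subr_eq0 -[X in _ == X]Ey; apply/eqP; ring.
- move: H; rewrite y1 eqxx => /(eigS _ _ y1) [[/sgN0//]|[Ex _]].
  have c1w : c1 p u0 xT e = w ^+ 2.
    by apply/eqP; rewrite -subr_eq0 -[X in _ == X]Ex; apply/eqP; ring.
  left; split=> //; apply: contraTneq d1 => w0.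
  by rewrite c1w w0 expr0n ltxx.
- move: H; rewrite y1 eqxx => /(eigS _ _ y1) [[/sgN0//]|[Ex _]].
  have /eqP : w ^+ 2 = 0 by rewrite -[RHS]oppr0 -[in RHS]Ex d2; ring.
  by rewrite expf_eq0 /= => /eqP w0; right.
Qed.

Variables (gam : R -> R * R) (s0 : R) (v w : R * R).
Hypothesis Dgam1 : is_derive s0 1 (fun s => (gam s).1) v.1.
Hypothesis Dgam2 : is_derive s0 1 (fun s => (gam s).2) v.2.
Hypothesis quad_gam : \forall s \near s0, quadrant (gam s).
Hypothesis Bgam : Bd (gam s0).
Hypothesis Tw : tangent_vector Bd (gam s0) w.
Hypothesis vw : lin_indep v w.

Let d2 s := c2 p u0 xT (gam s).
Let d1 s := c1 p u0 xT (gam s).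
Let d0 s := c0 p u0 xT (gam s).
Let h s := d1 s * d2 s - d0 s.

Let Dd2 : is_derive s0 1 d2 (b * v.1).
Proof. by apply: is_derive_eq; rewrite /GRing.scale /= /b; ring. Qed.
Let Dd1 : is_derive s0 1 d1 (a * v.1 + b * v.2).
Proof. by apply: is_derive_eq; rewrite /GRing.scale /= /a /b; ring. Qed.
Let Dd0 : is_derive s0 1 d0 (a * v.2).
Proof. by apply: is_derive_eq; rewrite /GRing.scale /= /a; ring. Qed.

Let dh := v.1 * grad1 a b k l (gam s0).1 (gam s0).2 + v.2 * grad2 a b k (gam s0).1.

Let Dh : is_derive s0 1 h dh.
Proof.
apply: is_derive_eq; rewrite /GRing.scale /= /dh /grad1 /grad2 /d2 /d1 /c1 /c2 -/a -/b -/k -/l.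
by ring.
Qed.

Let dh_neq0 : dh != 0.
Proof.
have B0 : Bd ((gam s0).1, (gam s0).2) by rewrite -surjective_pairing.
have Bd0 e : Bd e -> numer a b k l e.1 - e.2 * denom a b k e.1 = 0.
  by case=> _ _ ->; rewrite subrr.
apply: (lin_indep_kernel (gain_boundary_grad a_pos k02_pos k01_pos B0) vw).
  by case: Tw.
exact: tangent_grad Bd0 (Bd0 _ Bgam) Tw.
Qed.

Let cont f d : is_derive s0 1 f d -> {for s0, continuous (f : R -> R)}.
Proof. by case=> D _; exact/differentiable_continuous/derivable1_diffP. Qed.

Let h0 : h s0 = 0.
Proof. by case: Bgam => _ _ /eqP; rewrite -subr_eq0 -routhE => /eqP. Qed.

Let v2_0 : (gam s0).2 = 0 -> v.2 = 0.
Proof.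
move=> y0; apply: (nonneg_derive0 y0 _ Dgam2).
by apply: filterS quad_gam => s [].
Qed.

Lemma A_moves_across z : critical_eigenvalue p u0 xT (gam s0) z ->
  (gam s0).2 != 0 \/ z != 0 -> moves_across (fun s => A_mx p u0 xT (gam s)) s0 z.
Proof.
move=> /(critical_cases Bgam) [om [-> [[wN0 d1o _]|[-> y0 _ _]]]]; last first.
  by rewrite y0 !eqxx => -[].
move=> _; apply: (pair_moves_across (cont Dd2) (cont Dd1) (cont Dd0) wN0 d1o h0 Dh dh_neq0).
near=> s => x y y0; rewrite eigA; split=> [[[_ E]|//]|]; last by right.
by rewrite E eqxx in y0.
Unshelve. all: by end_near.
Qed.

Lemma S_moves_across z : critical_eigenvalue p u0 xT (gam s0) z ->
  (\forall s \near s0, (gam s).2 = 0) ->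
  moves_across (fun s => S_mx p u0 xT (gam s)) s0 z.
Proof.
move=> /(critical_cases Bgam) [om [-> H]] axis.
have y0 := nbhs_singleton axis.
case: H => [[wN0 d1o _]|[-> _ c1_0 c2_0]]; last first.
  apply: (@zero_moves_across _ d2 d1 s0 (cont Dd2) (cont Dd1) _ _ _ _ surge_neg c2_0 c1_0 Dd1).
    (* At such a point [v.2 = 0] and [c1 = 0], so the derivative of the Routh function is
       [v.1 * a * c2]; hence the derivative [a * v.1] of [c1] is nonzero. *)
    have := dh_neq0; rewrite /dh (v2_0 y0) mul0r mulr0 !addr0.
    have -> : grad1 a b k l (gam s0).1 (gam s0).2 = a * d2 s0 + b * d1 s0 by [].
    by rewrite [d1 s0]c1_0 mulr0 addr0 mulrA mulf_eq0 negb_or mulrC => /andP[].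
  by near=> s => x y; apply: eigS; near: s.
apply: (pair_moves_across (cont Dd2) (cont Dd1) (cont Dd0) wN0 d1o h0 Dh dh_neq0).
near=> s => x y yN0.
have ys : (gam s).2 = 0 by near: s.
rewrite (eigS _ _ ys); have -> : d0 s = 0 by rewrite /d0 /c0 ys mulr0.
exact: quad_cubic_root.
Unshelve. all: by end_near.
Qed.

(** The new case is the double eigenvalue 0. The second gain has a minimum where the curve touches
    the axis, so it, and with it [c0], vanishes quadratically. *)
Lemma A_branch_moves z : critical_eigenvalue p u0 xT (gam s0) z ->
  (\forall s \near s0, derivable (fun t => (gam t).2) s 1) ->
  derivable (derive1 (fun t => (gam t).2)) s0 1 ->
  exists2 lam : R -> R[i],
    eigenbranch (fun s => A_mx p u0 xT (gam s)) s0 z lam & nonzero_Re_speed lam s0.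
Proof.
move=> cz dg ddg; have [om [zE H]] := critical_cases Bgam cz.
case: H => [[wN0 _ _]|[wN0 y0 c1_0 c2_0]].
  have [|[lam br] speed] := A_moves_across cz; last by exists lam => //; exact: speed.
  by right; rewrite zE eq_complex /= negb_and wN0 orbT.
have v20 := v2_0 y0.
have d20 : derive1 (fun t => (gam t).2) s0 = 0.
  by rewrite derive1E; case: Dgam2 => _ ->.
have [q [cq qE]] := quadratic_coefficient y0 d20 dg ddg.
have caq : {for s0, continuous (fun s => a * q s)} by apply: cvgM => //; exact: cvg_cst.
rewrite zE wN0.
apply: (double_zero_branch (cont Dd2) (cont Dd1) (cont Dd0) c2_0 c1_0 caq _ Dh dh_neq0).
  near=> s; rewrite /d0 /c0 -/a -mulrA; congr (_ * _); near: s; exact: qE.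
by near=> s => x y H; apply/eigA; right.
Unshelve. all: by end_near.
Qed.

End Transversal.
End Thruster.

Theorem theorem3p2 (R : realType) (p : params R) (u0 : R)
  (M_unit : mass_mx p \in unitmx)
  (m_pos : 0 < mass p + m_uu p)
  (tau_decr : forall u : R, 0 < u -> derive1 (tau p) u < 0)
  (u0_straight : straight_motion p u0)
  (X_neg : X_uu p < 0)
  (tau0_pos : 0 < tau p 0)
  (k20_pos : 0 < k20 p u0) (k21_pos : 0 < k21 p u0)
  (k10_pos : 0 < k10 p u0) (k11_pos : 0 < k11 p u0)
  (k02_pos : 0 < k02 p u0) (k01_pos : 0 < k01 p u0) :
  (* Scenario (1) *)
  (xT2 p u0 < xT1 p u0 ->
    [/\ (* (1a) *)
        forall xT : R, xT <= xT2 p u0 ->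
          [/\ (* For xT = xT2 the rays with ep >= k02 * er never meet the curve
                 (Defs.ray_misses_curveC). *)
              forall er ep : R, 0 < er -> 0 <= ep ->
                xT < xT2 p u0 \/ ep < k02 p u0 * er ->
                exists2 s1 : R, 0 < s1 & forall s : R, 0 < s ->
                  (curveC p u0 xT (s * er, s * ep) <-> s = s1),
              forall er ep : R, 0 < er -> 0 <= ep -> forall s : R, 0 <= s ->
                (stabilized p u0 xT (s * er, s * ep) <->
                 exists2 s1 : R, 0 < s1 < s &
                   curveC p u0 xT (s1 * er, s1 * ep)),
              forall er ep : R, 0 < er -> 0 < ep -> forall s1 : R, 0 < s1 ->
                curveC p u0 xT (s1 * er, s1 * ep) ->
                exists lam : R -> R[i],
                  [/\ \forall s \near s1,
                        {for s, continuous (fun s => complex.Re (lam s))} /\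
                        {for s, continuous (fun s => complex.Im (lam s))},
                      \forall s \near s1,
                        [/\ ceigenvalue (A_mx p u0 xT (s * er, s * ep)) (lam s),
                            ceigenvalue (A_mx p u0 xT (s * er, s * ep))
                              (conjc (lam s)) &
                            complex.Im (lam s) != 0] &
                      crosses_downward (fun s => complex.Re (lam s)) s1],
              forall er : R, 0 < er -> forall s1 : R, 0 < s1 ->
                curveC p u0 xT (s1 * er, 0) ->
                (forall s : R, 0 <= s ->
                   eigenvalue (A_mx p u0 xT (s * er, 0)) 0) /\
                exists mu : R -> R,
                  [/\ \forall s \near s1, {for s, continuous mu},
                      \forall s \near s1,
                        [/\ eigenvalue (A_mx p u0 xT (s * er, 0)) (mu s),
                            eigenvalue (S_mx p u0 xT (s * er, 0)) (mu s) &
                            mup (mu s)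
                              (char_poly (S_mx p u0 xT (s * er, 0))) = 1%N] &
                      crosses_downward mu s1] &
              meets_r_axis (stability_boundary p u0 xT) /\
              (vertical_line (stability_boundary p u0 xT) \/
               exists (D : set R) (g : R -> R),
                 monotone_graph (stability_boundary p u0 xT) D g /\
                 (xT < xT2 p u0 ->
                  meets_psi_axis (stability_boundary p u0 xT) \/
                  ~ meets_psi_axis (stability_boundary p u0 xT) /\
                  vertical_asymptote D g (eps_r_star p u0 xT)))],
        (* (1b) *)
        forall xT : R, xTs p u0 <= xT ->
          forall er ep : R, 0 < er -> 0 < ep ->
            ~ stabilized p u0 xT (er, ep) &
        (* (1c) *)
        forall xT : R, xT2 p u0 < xT -> xT < xTs p u0 ->
          bounded_set (stability_region p u0 xT) /\
          exists (x0 x1 : R) (g : R -> R),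
            [/\ x0 < x1,
                stability_boundary p u0 xT =
                  graph_over [set x | x0 <= x <= x1] g &
                parabolic_arch x0 x1 g]]) /\
  (* Scenario (2) *)
  (xT1 p u0 <= xT2 p u0 ->
    (forall xT : R, xT < xT1 p u0 ->
       vertical_line (stability_boundary p u0 xT) \/
       exists (D : set R) (g : R -> R),
         monotone_graph (stability_boundary p u0 xT) D g) /\
    (forall xT : R, xT1 p u0 <= xT ->
       forall er ep : R, 0 <= er -> 0 <= ep ->
         ~ stabilized p u0 xT (er, ep))) /\
  (* Transversal crossing *)
  (forall xT : R, (exists e, stability_region p u0 xT e) ->
   forall e : R * R, stability_boundary p u0 xT e ->
     (exists z : R[i], critical_eigenvalue p u0 xT e z) /\
     forall (gam : R -> R * R) (s0 : R) (v w : R * R),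
       gam s0 = e ->
       is_derive s0 1 (fun s => (gam s).1) v.1 ->
       is_derive s0 1 (fun s => (gam s).2) v.2 ->
       (\forall s \near s0, @quadrant R (gam s)) ->
       tangent_vector (stability_boundary p u0 xT) e w ->
       lin_indep v w ->
       forall z : R[i], critical_eigenvalue p u0 xT e z ->
         [/\ e.2 != 0 \/ z != 0 ->
               moves_across (fun s => A_mx p u0 xT (gam s)) s0 z,
             (\forall s \near s0, (gam s).2 = 0) ->
               moves_across (fun s => S_mx p u0 xT (gam s)) s0 z &
             (* Here 0 may be a double eigenvalue of A, one of the two branches
                continuing the eigenvalue that is zero for all eps_r. *)
             (\forall s \near s0, derivable (fun t => (gam t).2) s 1) ->
             derivable (derive1 (fun t => (gam t).2)) s0 1 ->
               exists2 lam : R -> R[i],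
                 eigenbranch (fun s => A_mx p u0 xT (gam s)) s0 z lam &
                 nonzero_Re_speed lam s0]).
Proof.
have u0_pos : 0 < u0 by case: u0_straight => -[].
have surge_neg : surge_eig p u0 < 0.
  rewrite /surge_eig pmulr_llt0 ?invr_gt0 // addrC ltr_wnDr ?tau_decr //.
  by rewrite ltW // pmulr_llt0 // pmulr_rlt0.
have b_ge0 xT : (0 <= k20 p u0 - k21 p u0 * xT) = (xT <= xT2 p u0).
  by rewrite subr_ge0 /xT2 ler_pdivlMr // mulrC.
have b_gt0 xT : (0 < k20 p u0 - k21 p u0 * xT) = (xT < xT2 p u0).
  by rewrite subr_gt0 /xT2 ltr_pdivlMr // mulrC.
have a_gt0 xT : (0 < k10 p u0 - k11 p u0 * xT) = (xT < xT1 p u0).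
  by rewrite subr_gt0 /xT1 ltr_pdivlMr // mulrC.
have den : 0 < k01 p u0 * k21 p u0 + k02 p u0 * k11 p u0.
  by exact: addr_gt0 (mulr_gt0 _ _) (mulr_gt0 _ _).
(* As a function of [xT], [a k + b l] is affine with slope [- (k01 k21 + k02 k11) < 0], and [xTs] is
   its zero. *)
have w_gt0 xT : (0 < (k10 p u0 - k11 p u0 * xT) * k02 p u0
      + (k20 p u0 - k21 p u0 * xT) * k01 p u0) = (xT < xTs p u0).
  rewrite /xTs ltr_pdivlMr // -[RHS]subr_gt0; congr (0 < _); ring.
have w_right xT : xT < xT1 p u0 -> xT <= xT2 p u0 -> xT < xTs p u0.
  rewrite -a_gt0 -b_ge0 -w_gt0 => a0 b0.
  exact: ltr_wpDr (mulr_ge0 b0 (ltW k01_pos)) (mulr_gt0 a0 k02_pos).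
have gains xT er ep := @stabilizable_gains R p u0 xT M_unit m_pos k21_pos surge_neg
  k02_pos k01_pos (er, ep).
have shape xT : xT < xT1 p u0 -> xT <= xT2 p u0 ->
    stability_boundary p u0 xT = gain_boundary (k10 p u0 - k11 p u0 * xT)
      (k20 p u0 - k21 p u0 * xT) (k02 p u0) (k01 p u0).
  move=> x1 x2; apply: stability_boundaryE; rewrite ?a_gt0 ?w_gt0 //.
  exact: w_right.
split; [|split].
- move=> lt21; split.
  + move=> xT xT_le; have xT1' := le_lt_trans xT_le lt21.
    have a0 : 0 < k10 p u0 - k11 p u0 * xT by rewrite a_gt0.
    have b0 : 0 <= k20 p u0 - k21 p u0 * xT by rewrite b_ge0.
    have star : eps_r_star p u0 xT = (k10 p u0 - k11 p u0 * xT
        - (k20 p u0 - k21 p u0 * xT) * k02 p u0) / (k20 p u0 - k21 p u0 * xT) ^+ 2.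
      by rewrite /eps_r_star; congr (_ / _); ring.
    split.
    * move=> er ep er0 ep0 H; apply: ray_curve => //.
      by rewrite b_gt0.
    * by move=> er ep er0 ep0 s; exact: ray_stabilized.
    * by move=> er ep er0 ep0 s1; exact: ray_pair_crossing.
    * move=> er er0 s1 s10 C; split; first by move=> s _; exact: eigenvalue0_A.
      exact: axis_crossing.
    * rewrite shape //; split; first exact: gain_boundary_meets_r.
      have [|[D [f [MG asym]]]] := gain_boundary_monotone a0 k02_pos k01_pos b0; first by left.
      by right; exists D, f; split=> // lt2; rewrite star; apply: asym; rewrite b_gt0.
  + move=> xT xTs_le er ep er0 ep0 st.
    have [|_] := gains xT er ep _ st; first by split=> /=; exact: ltW.
    by rewrite w_gt0 ltNge xTs_le.
  + move=> xT gt2 lts.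
    have b0 : k20 p u0 - k21 p u0 * xT < 0 by rewrite ltNge b_ge0 -ltNge.
    have w0 := lts; rewrite -w_gt0 in w0.
    have a0 : 0 < k10 p u0 - k11 p u0 * xT.
      rewrite -(pmulr_lgt0 _ k02_pos); apply: (lt_le_trans w0).
      by rewrite gerDl mulr_le0_ge0 // ltW.
    split; first by rewrite stability_regionE //; exact: gain_region_bounded.
    rewrite stability_boundaryE //.
    do 3 eexists; split; [|exact: gain_boundary_arch|exact: gain_arch].
    exact: foot_lt.
- move=> le12; split=> xT.
    move=> lt1; have lt2 := lt_le_trans lt1 le12.
    rewrite shape ?(ltW lt2) //.
    have a0 : 0 < k10 p u0 - k11 p u0 * xT by rewrite a_gt0.
    have b0 : 0 <= k20 p u0 - k21 p u0 * xT by rewrite b_ge0 ltW.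
    have [|[D [f [MG _]]]] := gain_boundary_monotone a0 k02_pos k01_pos b0; first by left.
    by right; exists D, f.
  move=> ge1 er ep er0 ep0 st.
  by have [|+ _] := gains xT er ep _ st; rewrite // a_gt0 ltNge ge1.
move=> xT [[er ep] [Qe st]] e.
have [a0 w0] := gains xT er ep Qe st.
rewrite stability_boundaryE // => Be; split; first exact: critical_exists.
move=> gam s0 v w gs0 D1 D2 Qg Tw vw z cz; rewrite -gs0 in Be Tw cz *.
split.
- exact: (A_moves_across M_unit m_pos k21_pos surge_neg k02_pos k01_pos
    a0 w0 D1 D2 Be Tw vw cz).
- exact: (S_moves_across M_unit m_pos k21_pos surge_neg k02_pos k01_pos
    a0 w0 D1 D2 Qg Be Tw vw cz).
- exact: (A_branch_moves M_unit m_pos k21_pos surge_neg k02_pos k01_pos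
    a0 w0 D1 D2 Qg Be Tw vw cz).
Qed.
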